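(* Let $d \geq 3$ be an integer and let $p > \frac{d}{d-2}$. Then the discrete bilinear spherical maximal operator $T^*$ is bounded from $l^{p}(\mathbb{Z}^d)\times l^{\infty}(\mathbb{Z}^d)$ to $l^{p}(\mathbb{Z}^d)$; that is, there is a constant $C = C(d,p) < \infty$ such that for all $f \in l^p(\mathbb{Z}^d)$ and $g \in l^\infty(\mathbb{Z}^d)$, $$\|T^*(f,g)\|_{l^p(\mathbb{Z}^d)} \leq C\, \|f\|_{l^p(\mathbb{Z}^d)}\,\|g\|_{l^\infty(\mathbb{Z}^d)}.$$
   Context: For $u \in \mathbb{Z}^d$ write $u^2 = u_1^2 + \dots + u_d^2$. For $\lambda \in \mathbb{N} = \{1,2,3,\dots\}$ let $N(\lambda) = \#\{(u,v) \in \mathbb{Z}^d\times\mathbb{Z}^d : u^2+v^2 = \lambda\}$, the number of lattice points on the sphere of radius $\lambda^{1/2}$ in $\mathbb{R}^{2d}$ (positive for every $\lambda$ when $d\geq 3$). For functions $f,g:\mathbb{Z}^d \to \mathbb{C}$ the discrete bilinear spherical maximal function is $$T^*(f,g)(x) = \sup_{\lambda \in \mathbb{N}}\left| \frac{1}{N(\lambda)}\sum_{\substack{u,v\in\mathbb{Z}^d\\ u^2+v^2=\lambda}} f(x-u)\,g(x-v)\right|, \qquad x \in \mathbb{Z}^d.$$ *)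

(* Defs.v *)
From HB Require Import structures.
From mathcomp Require Import all_boot all_order all_algebra finmap.
From mathcomp Require Import all_classical all_reals all_analysis.
From mathcomp Require Export complex.
Set Implicit Arguments.
Unset Strict Implicit.
Unset Printing Implicit Defensive.
Import Order.TTheory GRing.Theory Num.Theory.

Local Open Scope classical_set_scope.
Local Open Scope ring_scope.
Local Open Scope complex_scope.

(* Z^d, carrying the discrete sigma-algebra so that [counting] is a measure
   on it and every function on it is measurable. *)
Definition lattice (d : nat) : Type := 'rV[int]_d.

HB.instance Definition _ (d : nat) := GRing.Zmodule.on (lattice d).

HB.instance Definition _ (d : nat) := isPointed.Build (lattice d) 0.

HB.instance Definition _ (d : nat) :=
  @isMeasurable.Build default_measure_display (lattice d)
    discrete_measurable discrete_measurable0
    discrete_measurableC discrete_measurableU.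

Definition sqnorm (d : nat) (u : lattice d) : int :=
  \sum_(i < d) (u : 'rV[int]_d) 0 i ^+ 2.

Definition lattice_sphere (d l : nat) : set (lattice d * lattice d) :=
  [set w | sqnorm w.1 + sqnorm w.2 = l%:Z].
Arguments lattice_sphere : clear implicits.

(* The sphere is a finite set, so [fset_set] is not its default value here,
   and the sum over [lattice_sphere d l] in [spherical_avg] is the full one. *)
Definition sphere_card (d l : nat) : nat := #|` fset_set (lattice_sphere d l)|.

Definition spherical_avg (R : realType) (d : nat) (f g : lattice d -> R[i])
    (l : nat) (x : lattice d) : R[i] :=
  (sphere_card d l)%:R^-1 *
  \sum_(w \in lattice_sphere d l) f (x - w.1) * g (x - w.2).

Definition spherical_max (R : realType) (d : nat) (f g : lattice d -> R[i])
    (x : lattice d) : \bar R :=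
  ereal_sup [set (ComplexField.Normc.normc (spherical_avg f g l x))%:E
            | l in [set l : nat | (0 < l)%N]].

(* For p = +oo this is the essential supremum of |f|, i.e. its supremum, as
   only the empty set is null for the counting measure. *)
Definition lp_norm (R : realType) (d : nat) (p : \bar R)
    (f : lattice d -> \bar R) : \bar R :=
  'N[@counting (lattice d) R]_p[f].

Definition clp_norm (R : realType) (d : nat) (p : \bar R)
    (f : lattice d -> R[i]) : \bar R :=
  lp_norm p (fun x => (ComplexField.Normc.normc (f x))%:E).

(* Main.v *)
(** Bounding [g] by [G], its sup norm, leaves linear averages of [|f|]: a point
    [u] gets the weight [G * r_d(l - |u|^2) / r_2d(l)], [r_d] being the number of
    representations as a sum of [d] squares. Choose a dyadic [N] with
    [N^2 / 4 < l <= N^2].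

    Lower bound [r_2d(l) >= c N^(2d-2)]: fix [2d-4] coordinates small, with the
    parity that makes the remainder odd; an odd [n] is a sum of four squares in
    at least [n] ways, since the [n] left ideals
    [Ln + L(t + (a+bt)i + (b-at)j - k)] of the Lipschitz order [L], with
    [a^2 + b^2 = -1] mod [n], are generated by distinct quaternions of norm [n].

    Upper bounds: count solutions modulo [L^2], [L = 8N], with the weight of a
    sum of three variables. The resulting Weyl sum at the frequency [k] is
    [<= 4 L^(5/2) m_k^(1/2)], where [m_k] is the number of [b < L] with [2kb]
    within [L] of a multiple of [L^2]; and [m_k > 3h] for at most [9 L^2 / h^2]
    values of [k]. So the moments of order [9/2] and more of the normalized Weyl
    sums are as small as those of a single major arc. If [d >= 5] this gives
    [r_d <= C N^(d-2)], and if [d = 3, 4] it gives the square mean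
    [sum_u r_d(l - |u|^2)^2 <= C N^(3d-4)], via the order [3d/2]. With [s = 1]
    or [s = 2] accordingly, the [s]-th power of the average is thus at most
    [C G^s] times the average of [|f|^s] over the cube of side [2N], and the
    Hardy-Littlewood inequality in [l^(p/s)] applies as [p > d/(d-2) >= s]. *)
Require Import Defs.
From mathcomp Require Import all_boot all_order all_algebra finmap zify ring lra.
From mathcomp Require Import all_classical all_reals all_analysis.
From mathcomp Require Import ess_sup_inf.
Set Implicit Arguments.
Unset Strict Implicit.
Unset Printing Implicit Defensive.
Import Order.TTheory GRing.Theory Num.Theory.
Local Open Scope ring_scope.

(** * Quaternions and four squares *)

(** Pigeonhole: the [(p + 1) / 2] residues [i^2] and the [(p + 1) / 2] residues [-1 - j^2] are
    distinct within each family, but number [p + 1] in all. *)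
Lemma sum_two_squares_modp (p : nat) : prime p -> odd p ->
  exists a b c : int, a ^+ 2 + b ^+ 2 + 1 = p%:Z * c.
Proof.
move=> pp op; have p0 : (0 < p)%N := prime_gt0 pp.
pose m := p./2.+1.
have pm : (p = m.-1.*2.+1)%N by rewrite /m /= -[LHS]odd_double_half op.
have sqI (i j : 'I_m) : (p%:Z %| i%:Z ^+ 2 - j%:Z ^+ 2)%Z -> i = j.
  rewrite subr_sqr dvdzE abszM Euclid_dvdM // => /orP[|] /dvdnP[k hk]; apply/val_inj => /=;
  have := ltn_ord i; have := ltn_ord j; case: k hk => [|k] hk; move: hk; rewrite ?mulSn; lia.
pose f (x : 'I_m + 'I_m) : 'I_p := Ordinal (ltn_pmod (match x with
  | inl i => (i * i)%N | inr j => (p * p - 1 - j * j)%N end) p0).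
have nf : ~~ injectiveb f.
  apply/negP => /injectiveP fI.
  have := leq_card _ fI; rewrite card_sum !card_ord; lia.
have modE (x y : nat) : (x %% p = y %% p)%N -> (p%:Z %| x%:Z - y%:Z)%Z.
  by move=> e; rewrite -eqz_mod_dvd !modz_nat e.
have jp (j : 'I_m) : (j * j <= p * p - 1)%N by have := ltn_ord j; nia.
have pz : ((p * p - 1)%N)%:Z = p%:Z * p%:Z - 1 by have : (0 < p * p)%N; nia.
case/injectivePn: nf => x [y ne /(congr1 val)] /=.
case: x y ne => [i|i] [j|j] ne /modE; first 1 last.
- rewrite -subzn // pz => /dvdzP[k hk]; exists i%:Z, j%:Z, (p%:Z + k); lia.
- rewrite -subzn // pz => /dvdzP[k hk]; exists i%:Z, j%:Z, (p%:Z - k); lia.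
- move=> h; case/negP: ne; apply/eqP; congr inr; apply/esym/sqI.
  move: h; rewrite -!(subzn (jp _)). by rewrite !PoszM -!expr2; congr (_ %| _)%Z; ring.
- by move=> h; case/negP: ne; apply/eqP; congr inl; apply/sqI; rewrite !expr2 -!PoszM.
Qed.

(** Induction on [n = m p], with [p] the least prime factor. If [p] does not divide [m], solutions
    modulo [m] and [p] are glued by the Chinese remainder theorem; otherwise the solution modulo [m]
    is lifted as in Hensel's lemma. *)
Lemma sum_two_squares_modn (n : nat) : odd n ->
  exists a b c : int, a ^+ 2 + b ^+ 2 + 1 = n%:Z * c.
Proof.
elim/ltn_ind: n => n IH on.
have [n1|n1] := leqP n 1.
  have -> : n = 1%N by case: n on n1 {IH} => [|[]].
  by exists 0, 0, 1.
have pp := pdiv_prime n1; have := dvdnP (pdiv_dvd n).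
move: (pdiv n) pp => p pp [m nE].
have p1 := prime_gt1 pp.
move: on; rewrite nE oddM => /andP[om op].
have [|a [b [c e]]] := IH m _ om; first by nia.
have [/dvdnP[m' mE]|ndv] := boolP (p %| m)%N; last first.
  have [a' [b' [c' e']]] := sum_two_squares_modp pp op.
  have cop : coprimez m p.
    by rewrite coprimezE /= coprime_sym prime_coprime.
  have [[u v] /= uv] := coprimezP _ _ cop.
  have vp : v * p = 1 - u * m by rewrite -uv; ring.
  have um : u * m = 1 - v * p by rewrite -uv; ring.
  pose x := a * (v * p) + a' * (u * m); pose y := b * (v * p) + b' * (u * m).
  suff /dvdzP[k hk] : ((m * p)%N%:Z %| x ^+ 2 + y ^+ 2 + 1)%Z.
    by exists x, y, k; rewrite hk mulrC.
  rewrite PoszM Gauss_dvdz //; apply/andP; split; apply/dvdzP.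
    have -> : x = a + m%:Z * (u * (a' - a)) by rewrite /x vp; ring.
    have -> : y = b + m%:Z * (u * (b' - b)) by rewrite /y vp; ring.
    exists (c + 2 * a * (u * (a' - a)) + m%:Z * (u * (a' - a)) ^+ 2 +
     2 * b * (u * (b' - b)) + m%:Z * (u * (b' - b)) ^+ 2).
    rewrite !mulrDl [c * _]mulrC -e; ring.
  have -> : x = a' + p%:Z * (v * (a - a')) by rewrite /x um; ring.
  have -> : y = b' + p%:Z * (v * (b - b')) by rewrite /y um; ring.
  exists (c' + 2 * a' * (v * (a - a')) + p%:Z * (v * (a - a')) ^+ 2 +
     2 * b' * (v * (b - b')) + p%:Z * (v * (b - b')) ^+ 2).
  rewrite !mulrDl [c' * _]mulrC -e'; ring.
(* Not both [a] and [b] are multiples of [p], as [p] would then divide 1. *)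
wlog pa : a b e / ~~ (p%:Z %| a)%Z.
  move=> H; have [pa|] := boolP (p%:Z %| a)%Z; last exact: (H a b e).
  have [pb|pb] := boolP (p%:Z %| b)%Z; last first.
    have [|x [y [z h]]] := H b a _ pb; first by rewrite -e; ring.
    by exists y, x, z; rewrite -h; ring.
  have : (p%:Z %| 1%R)%Z.
    have -> : 1 = m%:Z * c - a ^+ 2 - b ^+ 2 by rewrite -e; ring.
    rewrite !rpredB //; last 2 first.
    - by rewrite expr2 dvdz_mull.
    - by rewrite expr2 dvdz_mull.
    by rewrite mE PoszM dvdz_mulr // dvdz_mull.
  by rewrite dvdz1 /=; move: p1; case: (p) => [|[]].
have cop : coprimez (2 * a)%R p.
  rewrite coprimezMl !coprimezE /= ![coprime _ p]coprime_sym !prime_coprime //.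
  rewrite pa andbT; apply/negP => /dvdn_leq => /(_ isT); lia.
have [[u v] /= uv] := coprimezP _ _ cop.
(* Since [2 a u = 1 - v p], moving [a] by [- m u c] turns the value [m c] into
   [m p v c + m^2 (u c)^2], a multiple of [m p] because [p] divides [m]. *)
exists (a + m%:Z * (- u * c)), b, (v * c + m'%:Z * (u * c) ^+ 2).
have mE' : m%:Z = m' * p by rewrite mE PoszM.
rewrite PoszM.
have -> : (a + m%:Z * (- u * c)) ^+ 2 + b ^+ 2 + 1 =
 (a ^+2 + b^+2 + 1) - m%:Z * (u * (2 * a)) * c + m%:Z * m%:Z * (u * c)^+2 by ring.
have -> : u * (2 * a) = 1 - v * p by rewrite -[X in X - _]uv addrK.
rewrite e {4}mE'; ring.
Qed.

(** The Lipschitz order: [(a, b, c, d)] stands for [a + b i + c j + d k]. *)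
Definition quat : Type := int * int * int * int.

Definition qmk (a b c d : int) : quat := (a, b, c, d).

Definition qmul (x y : quat) : quat :=
  let: (a, b, c, d) := x in let: (a', b', c', d') := y in
  (a * a' - b * b' - c * c' - d * d', a * b' + b * a' + c * d' - d * c',
   a * c' - b * d' + c * a' + d * b', a * d' + b * c' - c * b' + d * a').

Definition qadd (x y : quat) : quat :=
  let: (a, b, c, d) := x in let: (a', b', c', d') := y in
  (a + a', b + b', c + c', d + d').

Definition qint (n : int) : quat := (n, 0, 0, 0).

Definition qopp (x : quat) : quat :=
  let: (a, b, c, d) := x in (- a, - b, - c, - d).

Definition qconj (x : quat) : quat :=
  let: (a, b, c, d) := x in (a, - b, - c, - d).

Definition qnorm (x : quat) : int :=
  let: (a, b, c, d) := x in a ^+ 2 + b ^+ 2 + c ^+ 2 + d ^+ 2.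

Ltac qcrush := rewrite /qmul /qadd /qint /qopp /qconj /qnorm /=;
  first [ring | congr (_, _, _, _); ring].

Lemma qnormM x y : qnorm (qmul x y) = qnorm x * qnorm y.
Proof. by case: x => [[[a b] c] d]; case: y => [[[a' b'] c'] d']; qcrush. Qed.

Lemma qmulA x y z : qmul x (qmul y z) = qmul (qmul x y) z.
Proof.
by case: x => [[[a b] c] d]; case: y => [[[a' b'] c'] d'];
   case: z => [[[a'' b''] c''] d'']; qcrush.
Qed.

Lemma qnorm_ge0 x : 0 <= qnorm x.
Proof. by case: x => [[[a b] c] d]; rewrite /= !addr_ge0 // sqr_ge0. Qed.

Lemma qnorm_eq0 x : qnorm x = 0 -> x = qint 0.
Proof.
case: x => [[[a b] c] d] /= /eqP.
rewrite !paddr_eq0 ?addr_ge0 ?sqr_ge0 // !sqrf_eq0.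
by move=> /andP[/andP[/andP[/eqP-> /eqP->] /eqP->] /eqP->].
Qed.

(** As [n] is odd, no remainder is exactly [n / 2]; this strictness makes division by quaternions of
    odd norm Euclidean. *)
Lemma nearest_multiple (n : nat) (y : int) : odd n ->
  exists b : int, 4 * (y - b * n%:Z) ^+ 2 < n%:Z ^+ 2.
Proof.
move=> on; have n0 : n%:Z != 0 by case: n on.
pose z := y + n./2%:Z; exists (z %/ n)%Z.
have := divz_eq z n; have := modz_ge0 z n0; have := ltz_mod z n0.
have nE : n%:Z = 1 + 2 * n./2%:Z.
  by rewrite -{1}(odd_double_half n) on -muln2 PoszD PoszM mulrC.
rewrite ger0_norm // => h1 h2 h3.
set q := (z %/ n)%Z in h3 *; set r := (z %% n)%Z in h1 h2 h3.
have -> : y - q * n = r - n./2%:Z by rewrite -[y](addrK n./2%:Z) -/z h3; ring.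
move: h1; rewrite nE; nia.
Qed.

(** The quotient rounds each coordinate of [x conj(q) / N(q)]. Each of the four errors is less than
    one half, hence [N(r) < N(q)]. *)
Lemma qdivision x q : odd `|qnorm q|%N ->
  exists b r, x = qadd (qmul b q) r /\ qnorm r < qnorm q.
Proof.
move=> oq; have nE : `|qnorm q|%N%:Z = qnorm q by rewrite gez0_abs // qnorm_ge0.
case Ey : (qmul x (qconj q)) => [[[y1 y2] y3] y4].
have [b1 h1] := nearest_multiple y1 oq; have [b2 h2] := nearest_multiple y2 oq.
have [b3 h3] := nearest_multiple y3 oq; have [b4 h4] := nearest_multiple y4 oq.
rewrite nE in h1 h2 h3 h4.
pose b := qmk b1 b2 b3 b4; pose r := qadd x (qopp (qmul b q)).
exists b, r; split.
  by rewrite /r /b; case: (x) => [[[? ?] ?] ?]; case: (q) => [[[? ?] ?] ?]; qcrush.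
have n0 : 0 < qnorm q by rewrite -nE; case: (`|qnorm q|%N) oq.
rewrite -(ltr_pM2r n0).
have -> : qnorm r * qnorm q = qnorm (qmul r (qconj q)).
  rewrite qnormM; congr (_ * _).
  by case: (q) => [[[? ?] ?] ?]; qcrush.
have -> : qmul r (qconj q) = (y1 - b1 * qnorm q, y2 - b2 * qnorm q,
   y3 - b3 * qnorm q, y4 - b4 * qnorm q).
  have e1 : y1 = (qmul x (qconj q)).1.1.1 by rewrite Ey.
  have e2 : y2 = (qmul x (qconj q)).1.1.2 by rewrite Ey.
  have e3 : y3 = (qmul x (qconj q)).1.2 by rewrite Ey.
  have e4 : y4 = (qmul x (qconj q)).2 by rewrite Ey.
  rewrite /r e1 e2 e3 e4 /b.
  by case: (x) => [[[? ?] ?] ?]; case: (q) => [[[? ?] ?] ?]; qcrush.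
rewrite /qnorm -/(qnorm q) -[qnorm q * qnorm q]expr2.
move: h1 h2 h3 h4; set Q := qnorm q; lia.
Qed.

Lemma int_parity (a : int) : exists (h : int) (e : bool), a = 2 * h + e%:R.
Proof.
exists (a %/ 2)%Z, ((a %% 2)%Z == 1).
rewrite {1}(divz_eq a 2) mulrC; congr (_ + _).
have : 0 <= (a %% 2)%Z by rewrite modz_ge0.
have : (a %% 2)%Z < 2 by rewrite ltz_pmod.
case: eqP => /= [->//|]; lia.
Qed.

(** An even norm means an even number of odd coordinates, so these split into two pairs of equal
    parity. According to the pairing, [t] is [1 - i], [1 - j] or [1 - k], which has norm 2. *)
Lemma qhalve q m : qnorm q = 2 * m -> exists t q',
  qmul t q = qadd q' q' /\ qnorm q = 2 * qnorm q'.
Proof.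
case: q => [[[a b] c] d].
have [a' [ea ->]] := int_parity a; have [b' [eb ->]] := int_parity b.
have [c' [ec ->]] := int_parity c; have [d' [ed ->]] := int_parity d.
move: a' b' c' d' {a b c d} => a b c d.
have odd_case (x : int) : 2 * x + 1 = 2 * m -> False by lia.
case: ea eb ec ed => [] [] [] [] /= h.
all: try (by case: (odd_case (2 * (a ^+ 2 + b ^+ 2 + c ^+ 2 + d ^+ 2 + a + b + c + d) + 1)); rewrite -h; ring).
all: try (by case: (odd_case (2 * (a ^+ 2 + b ^+ 2 + c ^+ 2 + d ^+ 2 + a + b + c) + 1)); rewrite -h; ring).
all: try (by case: (odd_case (2 * (a ^+ 2 + b ^+ 2 + c ^+ 2 + d ^+ 2 + a + b + d) + 1)); rewrite -h; ring).
all: try (by case: (odd_case (2 * (a ^+ 2 + b ^+ 2 + c ^+ 2 + d ^+ 2 + a + c + d) + 1)); rewrite -h; ring).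
all: try (by case: (odd_case (2 * (a ^+ 2 + b ^+ 2 + c ^+ 2 + d ^+ 2 + b + c + d) + 1)); rewrite -h; ring).
all: try (by case: (odd_case (2 * (a ^+ 2 + b ^+ 2 + c ^+ 2 + d ^+ 2 + a))); rewrite -h; ring).
all: try (by case: (odd_case (2 * (a ^+ 2 + b ^+ 2 + c ^+ 2 + d ^+ 2 + b))); rewrite -h; ring).
all: try (by case: (odd_case (2 * (a ^+ 2 + b ^+ 2 + c ^+ 2 + d ^+ 2 + c))); rewrite -h; ring).
all: try (by case: (odd_case (2 * (a ^+ 2 + b ^+ 2 + c ^+ 2 + d ^+ 2 + d))); rewrite -h; ring).
all: try (by exists (qmk 1 (-1) 0 0), (qmk (a + b + 1) (b - a) (c + d + 1) (d - c)); split; qcrush).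
all: try (by exists (qmk 1 (-1) 0 0), (qmk (a + b + 1) (b - a) (c + d) (d - c)); split; qcrush).
all: try (by exists (qmk 1 (-1) 0 0), (qmk (a + b) (b - a) (c + d + 1) (d - c)); split; qcrush).
all: try (by exists (qmk 1 (-1) 0 0), (qmk (a + b) (b - a) (c + d) (d - c)); split; qcrush).
all: try (by exists (qmk 1 0 (-1) 0), (qmk (a + c + 1) (b - d) (c - a) (b + d)); split; qcrush).
all: try (by exists (qmk 1 0 (-1) 0), (qmk (a + c) (b - d) (c - a) (b + d + 1)); split; qcrush).
all: try (by exists (qmk 1 0 0 (-1)), (qmk (a + d + 1) (b + c) (c - b) (d - a)); split; qcrush).
all: try (by exists (qmk 1 0 0 (-1)), (qmk (a + d) (b + c + 1) (c - b) (d - a)); split; qcrush).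
Qed.

(* The left ideal [Ln + L alpha] of the Lipschitz order [L] is principal for
   odd [n]: an element of minimal norm has odd norm (otherwise [qhalve] applies,
   2 being invertible mod n), and division by an element of odd norm is Euclidean. *)
Lemma quat_ideal_generator (n : nat) (al : quat) (m : int) :
  odd n -> qnorm al = n%:Z * m -> al.2 = -1 ->
  exists q g, al = qmul g q /\ qnorm q = n%:Z.
Proof.
move=> on nal al2.
pose I x := exists b g, x = qadd (qmul b (qint n%:Z)) (qmul g al).
have n0 : (0 < n)%N := odd_gt0 on.
have Iadd x y : I x -> I y -> I (qadd x y).
  move=> [b [g ->]] [b' [g' ->]]; exists (qadd b b'), (qadd g g').
  case: (al) b g b' g' => [[[? ?] ?] ?] [[[? ?] ?] ?] [[[? ?] ?] ?] [[[? ?] ?] ?] [[[? ?] ?] ?].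
  qcrush.
have Imul t x : I x -> I (qmul t x).
  move=> [b [g ->]]; exists (qmul t b), (qmul t g).
  case: (al) b g t => [[[? ?] ?] ?] [[[? ?] ?] ?] [[[? ?] ?] ?] [[[? ?] ?] ?].
  qcrush.
have Iopp x : I x -> I (qopp x).
  move=> Ix; have -> : qopp x = qmul (qint (-1)) x; last exact: Imul.
  by case: (x) => [[[? ?] ?] ?]; qcrush.
have In x : I (qmul x (qint n%:Z)).
  exists x, (qint 0); case: (al) x => [[[? ?] ?] ?] [[[? ?] ?] ?]; qcrush.
have Ial : I al.
  exists (qint 0), (qint 1); case: (al) => [[[? ?] ?] ?]; qcrush.
have [q [Iq q0 qmin]] : exists q, [/\ I q, 0 < qnorm q &
    forall x, I x -> qnorm x < qnorm q -> qnorm x = 0].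
  have [k] := ubnP `|qnorm (qmul (qint 1) (qint n%:Z))|%N.
  have : 0 < qnorm (qmul (qint 1) (qint n%:Z)) by rewrite /= ; nia.
  elim: k (qmul (qint 1) (qint n%:Z)) (In (qint 1)) => // k IH y Iy y0 yk.
  have [[x [Ix xy x0]]|nx] := pselect (exists x, [/\ I x, qnorm x < qnorm y & qnorm x != 0]).
    have xp : 0 < qnorm x by rewrite lt_def x0 qnorm_ge0.
    apply: (IH x Ix xp); lia.
  exists y; split => // x Ix xy; apply/eqP/negPn/negP => x0.
  by case: nx; exists x.
have oq : odd `|qnorm q|%N.
  apply/negPn/negP => eq.
  have [|t [q' [tq nq']]] := @qhalve q (`|qnorm q|./2)%N%:Z.
    rewrite -[LHS]gez0_abs ?(ltW q0) // -{1}(odd_double_half `|qnorm q|%N) (negbTE eq).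
    by rewrite add0n -muln2 PoszM mulrC.
  have Iq' : I q'.
    (* Here [n = 1 + 2 (n./2)] and [t q = 2 q']. The norm of [q'] is half of the positive minimum, a
       contradiction. *)
    have -> : q' = qadd (qmul q' (qint n%:Z)) (qopp (qmul (qint n./2%:Z) (qmul t q))).
      have nE : n%:Z = 1 + 2 * n./2%:Z.
        by rewrite -{1}(odd_double_half n) on -muln2 PoszD PoszM mulrC.
      by rewrite tq nE; case: (q') => [[[? ?] ?] ?]; qcrush.
    by apply: Iadd => //; apply/Iopp/Imul/Imul.
  have := qmin q' Iq'; lia.
have divq x : I x -> exists b, x = qmul b q.
  move=> Ix; have [b [r [xE rq]]] := qdivision x oq.
  have Ir : I r.
    have -> : r = qadd x (qopp (qmul b q)).
      rewrite xE; case: (qmul b q) (r) => [[[? ?] ?] ?] [[[? ?] ?] ?]; qcrush.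
    by apply: Iadd => //; apply/Iopp/Imul.
  exists b; rewrite xE (qnorm_eq0 (qmin _ Ir rq)).
  by case: (qmul b q) => [[[? ?] ?] ?]; qcrush.
have [g alE] := divq _ Ial; exists q, g; split => //.
have [b nE] := divq _ (In (qint 1)).
have [k nk] : exists k, qnorm q = n%:Z * k.
  have [b' [g' ->]] := Iq.
  have -> : qnorm (qadd (qmul b' (qint n%:Z)) (qmul g' al)) =
    n%:Z ^+ 2 * qnorm b' + qnorm (qmul g' al) + n%:Z * 2 * (qmul b' (qconj (qmul g' al))).1.1.1.
    case: (b') (qmul g' al) => [[[? ?] ?] ?] [[[? ?] ?] ?]; qcrush.
  rewrite qnormM nal.
  exists (n%:Z * qnorm b' + qnorm g' * m + 2 * (qmul b' (qconj (qmul g' al))).1.1.1); ring.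
have nn0 : n%:Z != 0 :> int by rewrite eqz_nat -lt0n.
(* From [n = b q] and [N(q) = n k] follows [conj(q) = k b]; so [k] divides [q], and then [al = g q],
   whose last coordinate is [-1]. Hence [k = 1]. *)
have cE : qconj q = qmul (qint k) b.
  have : qmul (qint n%:Z) (qconj q) = qmul (qint n%:Z) (qmul (qint k) b).
    have -> : qmul (qint n%:Z) (qconj q) = qmul (qmul (qint 1) (qint n%:Z)) (qconj q).
      by case: (q) => [[[? ?] ?] ?]; qcrush.
    rewrite nE -qmulA.
    have -> : qmul q (qconj q) = qint (qnorm q) by case: (q) => [[[? ?] ?] ?]; qcrush.
    by rewrite nk; case: (b) => [[[? ?] ?] ?]; qcrush.
  case: (qconj q) (qmul (qint k) b) => [[[x1 x2] x3] x4] [[[z1 z2] z3] z4].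
  case=> e1 e2 e3 e4; congr (_, _, _, _); apply: (mulfI nn0).
  - by move: e1; lia.
  - by move: e2; lia.
  - by move: e3; lia.
  - by move: e4; lia.
suff : k = 1 by rewrite nk => ->; rewrite mulr1.
have k1 : -1 = k * (qmul g (qconj b)).2.
  rewrite -al2 alE.
  have -> : q = qconj (qconj q) by case: (q) => [[[? ?] ?] ?]; qcrush.
  by rewrite cE; case: (g) (b) => [[[? ?] ?] ?] [[[? ?] ?] ?]; rewrite /=; ring.
have kp : 0 < k by rewrite -(pmulr_rgt0 _ (_ : 0 < n%:Z)) ?ltz_nat // -nk.
have : (k %| -1)%Z by rewrite [X in (_ %| X)%Z]k1 dvdz_mulr.
rewrite dvdzE /= dvdn1 => /eqP; lia.
Qed.

(** If [i] and [j] gave the same generator, [al i] times the conjugate of [al j] would be divisible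
    by [n]; its last coordinate is [2 (i - j)] modulo [n], so [i = j]. *)
Lemma four_squares_many (n : nat) : odd n ->
  exists f : 'I_n -> quat, injective f /\ forall i, qnorm (f i) = n%:Z.
Proof.
move=> on; have [a [b [c abc]]] := sum_two_squares_modn on.
(* The norm of [al s] is [(1 + s^2) (a^2 + b^2 + 1)], a multiple of [n]. *)
pose al (s : int) := qmk s (a + b * s) (b - a * s) (-1).
have h s : {qg | al s = qmul qg.2 qg.1 /\ qnorm qg.1 = n%:Z}.
  apply: cid; have [] := @quat_ideal_generator n (al s) (c * (1 + s ^+ 2)) on.
  - by rewrite mulrA -abc /= ; ring.
  - by [].
  by move=> q [g [? ?]]; exists (q, g).
exists (fun i => (sval (h i%:Z)).1); split; last by move=> i; case: (svalP (h i%:Z)).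
move=> i j eij.
have [ei nq] := svalP (h i%:Z); have [ej _] := svalP (h j%:Z).
move: ei ej nq; rewrite eij.
move: (sval (h i%:Z)).2 (sval (h j%:Z)).2 (sval (h j%:Z)).1 => g g' q ei ej nq.
have : qmul (al i%:Z) (qconj (al j%:Z)) = qmul (qint n%:Z) (qmul g (qconj g')).
  rewrite ei ej -nq.
  by case: (g) (g') (q) => [[[? ?] ?] ?] [[[? ?] ?] ?] [[[? ?] ?] ?]; qcrush.
move=> /(congr1 snd).
have -> : (qmul (al i%:Z) (qconj (al j%:Z))).2 =
  2 * (i%:Z - j%:Z) - (a ^+ 2 + b ^+ 2 + 1) * (i%:Z - j%:Z) by rewrite /=; ring.
have -> : (qmul (qint n%:Z) (qmul g (qconj g'))).2 = n%:Z * (qmul g (qconj g')).2.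
  by case: (qmul g (qconj g')) => [[[? ?] ?] ?]; rewrite /=; ring.
move: (_.2) => z; rewrite abc => hz.
have : (n%:Z %| 2 * (i%:Z - j%:Z))%Z.
  apply/dvdzP; exists (z + c * (i%:Z - j%:Z)).
  have -> : (z + c * (i%:Z - j%:Z)) * n%:Z = n%:Z * z + n%:Z * c * (i%:Z - j%:Z) by ring.
  by rewrite -hz; ring.
rewrite Gauss_dvdzr; last by rewrite coprimezE /= coprimen2.
case/dvdzP => k hk; apply/val_inj => /=.
have := ltn_ord i; have := ltn_ord j.
by have [k0|k0|k0] := ltgtP k 0; [nia|nia|rewrite k0 mul0r in hk; lia].
Qed.

(** * Lower bound for the number of lattice points on a sphere *)

(** The cube [[-N, N]^d] is indexed by a finite type, the index [N] standing for the coordinate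
    0. *)
Definition ctrsq (d N : nat) (v : {ffun 'I_d -> 'I_(2 * N).+1}) : int :=
  \sum_i ((v i)%:Z - N%:Z) ^+ 2.


(** For [m <= N^2] no solution leaves the cube, so this is the full number of representations of [m]
    by [2 d] squares. *)
Definition pair_rep (d N : nat) (m : int) : nat :=
  #|[set p : {ffun 'I_d -> 'I_(2 * N).+1} * {ffun 'I_d -> 'I_(2 * N).+1} |
     ctrsq p.1 + ctrsq p.2 == m]|.

Lemma leq_sum_inj (I J : finType) (f : I -> J) (F : J -> nat) :
  injective f -> (\sum_i F (f i) <= \sum_j F j)%N.
Proof.
move=> fI.
have -> : (\sum_i F (f i) = \sum_(j in f @: [set: I]) F j)%N.
  rewrite big_imset /=; last by move=> x y _ _; exact: fI.
  by apply: eq_bigl => i; rewrite inE.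
by rewrite big_mkcond; apply: leq_sum => j _; case: ifP.
Qed.

Lemma card_sum_pred (T : finType) (P : pred T) : (#|[set x | P x]| = \sum_x P x)%N.
Proof.
by rewrite -sum1_card big_mkcond; apply: eq_bigr => x _; rewrite inE; case: (P x).
Qed.

Section Concat.
Context (N a b : nat).
Local Notation V k := {ffun 'I_k -> 'I_(2 * N).+1}.

Definition vcat (p : V a * V b) : V (a + b) :=
  [ffun i => match fintype.split i with inl j => p.1 j | inr j => p.2 j end].

Lemma vcat_inj : injective vcat.
Proof.
move=> [x y] [x' y'] /ffunP e; congr (_, _); apply/ffunP => i.
  by have := e (lshift b i); rewrite !ffunE (unsplitK (inl _ i)).
by have := e (rshift a i); rewrite !ffunE (unsplitK (inr _ i)).
Qed.

Lemma ctrsq_vcat p : ctrsq (vcat p) = ctrsq p.1 + ctrsq p.2.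
Proof.
rewrite /ctrsq big_split_ord /=; congr (_ + _); apply: eq_bigr => i _.
  by rewrite ffunE (unsplitK (inl _ i)).
by rewrite ffunE (unsplitK (inr _ i)).
Qed.

End Concat.

(* Split as [3 + 1]: [u] receives three of the four coordinates and [v] one, which
   leaves at least [d - 3] free coordinates in each. *)
Lemma four_squares_box (N n : nat) : odd n -> (n <= N ^ 2)%N ->
  (n <= \sum_(p : {ffun 'I_3 -> 'I_(2 * N).+1} * {ffun 'I_1 -> 'I_(2 * N).+1})
    ((ctrsq p.1 + ctrsq p.2)%R == n%:Z))%N.
Proof.
move=> on nN; have [f [fI fn]] := four_squares_many on.
have sqN (x : int) : x ^+ 2 <= n%:Z -> `|x| <= N%:Z.
  move=> h; rewrite -ler_sqr ?nnegrE // real_normK ?num_real //.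
  by apply: le_trans h _; rewrite -[N%:Z]natz -natrX natz.
pose toI (x : int) : 'I_(2 * N).+1 := inord (absz (x + N%:Z)%R).
have toIE x : `|x| <= N%:Z -> (toI x)%:Z - N%:Z = x.
  by move=> h; rewrite inordK; lia.
pose h (i : 'I_n) := let: (x, y, z, w) := f i in
  ([ffun j : 'I_3 => nth (toI 0) [:: toI x; toI y; toI z] j], [ffun j : 'I_1 => toI w]).
have bd i : let: (x, y, z, w) := f i in
    [/\ `|x| <= N%:Z, `|y| <= N%:Z, `|z| <= N%:Z & `|w| <= N%:Z].
  have := fn i; case: (f i) => [[[x y] z] w] /= e.
  have := sqr_ge0 x; have := sqr_ge0 y; have := sqr_ge0 z; have := sqr_ge0 w.
  by move=> *; split; apply: sqN; lia.
have hI : injective h.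
  move=> i j; rewrite /h; have := bd i; have := bd j; have := fI i j.
  case: (f i) (f j) => [[[x y] z] w] [[[x' y'] z'] w'] H [b1 b2 b3 b4] [b1' b2' b3' b4'].
  move=> [/ffunP e /ffunP e']; apply: H.
  have := e ord0; have := e (inord 1); have := e (inord 2); have := e' ord0.
  rewrite !ffunE /= !inordK //= => e4 e3 e2 e1.
  congr (_, _, _, _).
  - by rewrite -(toIE x) // e1 toIE.
  - by rewrite -(toIE y) // e2 toIE.
  - by rewrite -(toIE z) // e3 toIE.
  - by rewrite -(toIE w) // e4 toIE.
apply: leq_trans (leq_sum_inj _ hI).
rewrite (eq_bigr (fun=> 1%N)) ?sum_nat_const ?card_ord ?muln1 // => i _.
rewrite /h; have := bd i; have := fn i.
case: (f i) => [[[x y] z] w] e [b1 b2 b3 b4].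
rewrite /ctrsq /= big_ord1 !big_ord_recr big_ord0 /= !ffunE /= !toIE // add0r.
by move: e => /= ->; rewrite eqxx.
Qed.

Lemma pair_rep_ge_sum (d N : nat) (m : int) : (pair_rep d.+3 N m >=
  \sum_(yt : {ffun 'I_d -> 'I_(2 * N).+1} * {ffun 'I_d.+2 -> 'I_(2 * N).+1})
  \sum_(p : {ffun 'I_3 -> 'I_(2 * N).+1} * {ffun 'I_1 -> 'I_(2 * N).+1})
    ((ctrsq p.1 + ctrsq p.2)%R == (m - (ctrsq yt.1 + ctrsq yt.2))%R))%N.
Proof.
rewrite /pair_rep card_sum_pred pair_bigA /=.
pose f (q : ({ffun 'I_d -> 'I_(2 * N).+1} * {ffun 'I_d.+2 -> 'I_(2 * N).+1}) *
  ({ffun 'I_3 -> 'I_(2 * N).+1} * {ffun 'I_1 -> 'I_(2 * N).+1})) :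
  {ffun 'I_d.+3 -> 'I_(2 * N).+1} * {ffun 'I_d.+3 -> 'I_(2 * N).+1} :=
  (vcat (q.2.1, q.1.1), vcat (q.2.2, q.1.2)).
have fI : injective f.
  move=> [[y t] [x s]] [[y' t'] [x' s']] [e1 e2].
  by have [-> ->] := @vcat_inj N 3 d _ _ e1; have [-> ->] := @vcat_inj N 1 d.+2 _ _ e2.
apply: leq_trans (leq_sum_inj _ fI); apply: leq_sum => [[[y t] [x s]]] _.
have -> : ctrsq (f (y, t, (x, s))).1 + ctrsq (f (y, t, (x, s))).2 =
    ctrsq x + ctrsq y + (ctrsq s + ctrsq t).
  by congr (_ + _); [exact: (@ctrsq_vcat N 3 d (x, y))|exact: (@ctrsq_vcat N 1 d.+2 (s, t))].
by rewrite /= eq_sym subr_eq eq_sym addrACA.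
Qed.

(** In dimension [d + 3], the [2 d + 2] free coordinates are [2 a] with [a < K], up to one parity
    bit. Each of the [K^(2 d + 2)] choices leaves an odd integer which is at least [l / 2], hence at
    least [l / 2] ways to complete by four squares; and [K] is comparable to [N]. *)
Lemma pair_rep_ge (d : nat) : (3 <= d)%N -> exists2 c : nat, (0 < c)%N &
  forall n l, (0 < l)%N -> (l <= (2 ^ n) ^ 2)%N -> ((2 ^ n) ^ 2 < 4 * l)%N ->
  ((2 ^ n) ^ (2 * d - 2) <= c * pair_rep d (2 ^ n) l%:Z)%N.
Proof.
case: d => [|[|[|d]]] // _.
(* This [e] satisfies [32 (2 d + 2) <= 4^e], which keeps the squares of the free coordinates below
   [l / 2]. *)
pose e := (d + 6)%N; exists (8 * 2 ^ (e * (2 * d + 2)))%N; first by rewrite muln_gt0 expn_gt0.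
move=> n l l0 lN Nl; set N := (2 ^ n)%N in lN Nl *.
(* Truncated subtraction gives [K = 1] at small scales, where only the parity bit survives. *)
pose K := (2 ^ (n - e))%N.
have K0 : (0 < K)%N by rewrite expn_gt0.
have N0 : (0 < N)%N by rewrite expn_gt0.
have KN : (N <= 2 ^ e * K)%N by rewrite -expnD leq_exp2l //; lia.
have KN' : (2 * K - 1 <= N)%N.
  rewrite /K /N; case: (n) => [|k]; first by [].
  have : (2 ^ (k.+1 - e) <= 2 ^ k)%N by rewrite leq_exp2l //; lia.
  by rewrite (expnS 2 k); lia.
(* Added to one coordinate, this bit makes [l - Q q] odd whatever the parity of [l]. *)
pose ep : bool := ~~ odd l.
have hidx (a : 'I_K) (b : bool) : (N + 2 * a + b < (2 * N).+1)%N.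
  by have := ltn_ord a; case: b; lia.
pose f (q : {ffun 'I_d -> 'I_K} * {ffun 'I_d.+2 -> 'I_K}) :
    {ffun 'I_d -> 'I_(2 * N).+1} * {ffun 'I_d.+2 -> 'I_(2 * N).+1} :=
  ([ffun i => Ordinal (hidx (q.1 i) false)], [ffun i => Ordinal (hidx (q.2 i) ((i == ord0) && ep))]).
have fI : injective f.
  move=> [x y] [x' y'] [/ffunP h1 /ffunP h2]; congr (_, _); apply/ffunP => i; apply/val_inj.
    by have := h1 i; rewrite !ffunE => /(congr1 val) /=; lia.
  by have := h2 i; rewrite !ffunE => /(congr1 val) /=; lia.
pose Q q := ctrsq (f q).1 + ctrsq (f q).2.
have Q1 q : ctrsq (f q).1 = \sum_i (2 * (q.1 i)%:Z) ^+ 2.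
  by apply: eq_bigr => i _; rewrite ffunE /=; congr (_ ^+ 2); lia.
have Q2 q : ctrsq (f q).2 = \sum_i (2 * (q.2 i)%:Z + ((i == ord0) && ep)%:Z) ^+ 2.
  by apply: eq_bigr => i _; rewrite ffunE /=; congr (_ ^+ 2); lia.
have Qpar q : exists s : int, Q q = 2 * s + ep%:Z.
  exists (\sum_i 2 * (q.1 i)%:Z ^+ 2 + \sum_i (2 * (q.2 i)%:Z ^+ 2 + 2 * (q.2 i)%:Z * ((i == ord0) && ep)%:Z)).
  rewrite /Q Q1 Q2 mulrDr -addrA; congr (_ + _).
    by rewrite mulr_sumr; apply: eq_bigr => i _; ring.
  have -> : ep%:Z = \sum_(i < d.+2) ((i == ord0) && ep)%:Z.
    by rewrite big_ord_recl /= big1 ?addr0.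
  rewrite mulr_sumr -big_split; apply: eq_bigr => i _ /=.
  by case: (_ && _) => /=; ring.
have Q0 q : 0 <= Q q.
  by rewrite addr_ge0 //; apply: sumr_ge0 => i _; exact: sqr_ge0.
have Qle q : 2 * Q q <= l%:Z.
  have [ne|ne] := ltnP n e.
    have K1 : K = 1%N by rewrite /K; have -> : (n - e = 0)%N by lia.
    have a0 (a : 'I_K) : a = 0%N :> nat by have := ltn_ord a; lia.
    have -> : Q q = ep%:Z.
      rewrite /Q Q1 Q2 big1 => [|i _]; last by rewrite a0.
      rewrite big_ord_recl /= big1 => [|i _]; last by rewrite a0.
      by rewrite a0 /= mulr0; case: (ep).
    by have := odd_double_half l; rewrite /ep; case: (odd l) => /=; lia.
  have tb (x : int) : 0 <= x -> x <= 2 * K%:Z -> x ^+ 2 <= 4 * K%:Z ^+ 2.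
    move=> x0 xK; have -> : 4 * K%:Z ^+ 2 = (2 * K%:Z) ^+ 2 by ring.
    by rewrite ler_sqr ?nnegrE // (le_trans x0).
  have : Q q <= (2 * d + 2)%N%:Z * (4 * K%:Z ^+ 2).
    have -> : (2 * d + 2)%N%:Z * (4 * K%:Z ^+ 2) =
      \sum_(i < d) (4 * K%:Z ^+ 2) + \sum_(i < d.+2) (4 * K%:Z ^+ 2).
      by rewrite !sumr_const !card_ord -mulrnDr -[RHS]mulr_natr mulrC; congr (_ * _); rewrite natz; congr Posz; lia.
    rewrite /Q Q1 Q2 lerD //; apply: ler_sum => i _; apply: tb; try lia.
    - by have := ltn_ord (q.1 i); lia.
    - by have := ltn_ord (q.2 i); case: (_ && _) => /=; lia.
  have NE : N = (2 ^ e * K)%N by rewrite -expnD subnKC.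
  have e4 : (32 * (2 * d + 2) <= (2 ^ e) ^ 2)%N.
    rewrite -expnM /e; have -> : ((d + 6) * 2 = d + (d + 12))%N by lia.
    have dd : (d < 2 ^ d)%N by exact: ltn_expl.
    rewrite expnD; apply: (@leq_trans (2 ^ d * (2 ^ 12))); last by rewrite leq_mul2l leq_exp2l //; lia.
    by rewrite (_ : 2 ^ 12 = 4096)%N //; lia.
  move: Nl; rewrite NE expnMn => Nl h.
  have : (32 * (2 * d + 2) * K ^ 2 < 4 * l)%N.
    by apply: leq_ltn_trans Nl; rewrite leq_mul2r e4 orbT.
  move: h; have -> : K%:Z ^+ 2 = (K ^ 2)%N%:Z by rewrite -[RHS]natz natrX natz.
  move: (K ^ 2)%N => k h; rewrite -ltz_nat !PoszM; lia.
have Qn q : exists m : nat, [/\ l%:Z - Q q = m%:Z, odd m, (m <= N ^ 2)%N & (l <= 2 * m)%N].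
  have := Q0 q; have := Qle q; have [s sE] := Qpar q => h1 h0.
  exists (absz (l%:Z - Q q)%R); have lQ : 0 <= l%:Z - Q q by lia.
  split; [by rewrite gez0_abs| |by lia|by lia].
  move: sE; rewrite /ep; have := odd_double_half l; have := odd_double_half (absz (l%:Z - Q q)%R).
  by case: (odd l) => /=; case: (odd _) => //=; lia.
have key : (K ^ (2 * d + 2) * l <= 2 * pair_rep d.+3 N l%:Z)%N.
  apply: (@leq_trans (2 * \sum_(q : {ffun 'I_d -> 'I_K} * {ffun 'I_d.+2 -> 'I_K})
    \sum_(p : {ffun 'I_3 -> 'I_(2 * N).+1} * {ffun 'I_1 -> 'I_(2 * N).+1})
    ((ctrsq p.1 + ctrsq p.2)%R == (l%:Z - Q q)%R))); last first.
    rewrite leq_mul2l /=; apply: leq_trans (pair_rep_ge_sum d N l%:Z).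
    exact: leq_trans (leq_sum_inj _ fI).
  apply: (@leq_trans (2 * \sum_(q : {ffun 'I_d -> 'I_K} * {ffun 'I_d.+2 -> 'I_K}) (l.+1)./2)).
    rewrite sum_nat_const card_prod !card_ffun !card_ord -expnD.
    have -> : (d + d.+2 = 2 * d + 2)%N by lia.
    rewrite mulnCA leq_mul2l; apply/orP; right; lia.
  rewrite leq_mul2l; apply: leq_sum => q _.
  have [m [mE om mN lm]] := Qn q; rewrite mE.
  apply: leq_trans (four_squares_box om mN); lia.
have -> : (2 * d.+3 - 2 = (2 * d + 2) + 2)%N by lia.
rewrite expnD; apply: (@leq_trans ((2 ^ e * K) ^ (2 * d + 2) * (4 * l))).
  by apply: leq_mul; [rewrite leq_exp2r //; lia|exact: ltnW].
rewrite expnMn -expnM; move: key; move: (2 ^ _)%N (K ^ _)%N (pair_rep _ _ _) => u v w key.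
have -> : (u * v * (4 * l) = 4 * u * (v * l))%N by lia.
have -> : (8 * u * w = 4 * u * (2 * w))%N by lia.
by rewrite leq_mul2l key orbT.
Qed.

(** * Multiplication by [2k] modulo [L ^ 2] *)

Lemma card_le_spread (n D : nat) (A : {set 'I_n}) :
  (forall x y, x \in A -> y \in A -> (x <= y + D)%N) -> (#|A| <= D.+1)%N.
Proof.
move=> h; have [->|[x0 x0A]] := set_0Vmem A; first by rewrite cards0.
have [x xA xmin] := @arg_minnP _ x0 (mem A) (fun i : 'I_n => val i) x0A.
rewrite -[X in (_ <= X)%N](card_ord D.+1).
pose f (y : 'I_n) : 'I_D.+1 := inord (y - x).
rewrite -(@card_in_image _ _ f A) ?max_card // => y z yA zA; rewrite /f => /(congr1 val) /=.
rewrite !inordK; first last.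
- by have := h _ _ yA xA; have := xmin _ yA; rewrite /=; lia.
- by have := h _ _ zA xA; have := xmin _ zA; rewrite /=; lia.
have /= := xmin _ yA; have /= := xmin _ zA => h1 h2 h3; apply/val_inj => /=; lia.
Qed.

Definition close_mult (L x : nat) : bool :=
  (x %% L ^ 2 <= L)%N || (L ^ 2 - x %% L ^ 2 <= L)%N.

(** Its cardinality is the [m_k] of the overview; it is large only if [2 k / L^2] is near a fraction
    of small denominator. *)
Definition close_set (L k : nat) : {set 'I_L} :=
  [set b : 'I_L | close_mult L (2 * k * b)].

Lemma close_multP L x : (0 < L)%N ->
  reflect (exists c : int, `|x%:Z - c * L%:Z ^+ 2| <= L%:Z) (close_mult L x).
Proof.
move=> L0; have M0 : (0 < L ^ 2)%N by rewrite expn_gt0 L0.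
have xE : x%:Z = (x %/ L ^ 2)%N%:Z * L%:Z ^+ 2 + (x %% L ^ 2)%N%:Z.
  by rewrite {1}(divn_eq x (L ^ 2)) PoszD PoszM -!natz natrX.
have LE : L%:Z ^+ 2 = (L ^ 2)%N%:Z by rewrite -!natz natrX.
have := ltn_pmod x M0; rewrite /close_mult.
move: xE; rewrite LE; move: (x %/ L ^ 2)%N (x %% L ^ 2)%N => q r.
move: (L ^ 2)%N M0 => M M0 -> rM; apply: (iffP orP).
  case=> h; first by exists q%:Z; lia.
  by exists (q%:Z + 1); lia.
move=> [c]; have -> : q%:Z * M%:Z + r%:Z - c * M%:Z = (q%:Z - c) * M%:Z + r%:Z by ring.
move: (q%:Z - c) => e h.
have [e0|e0] := leP 0 e.
  have : 0 <= e * M%:Z by rewrite mulr_ge0.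
  by move=> h1; left; move: h h1; move: (e * M%:Z) => z; lia.
have : 0 <= (- 1 - e) * M%:Z by rewrite mulr_ge0 //; lia.
by rewrite mulrBl mulN1r => h1; right; move: h h1; move: (e * M%:Z) => z; lia.
Qed.

(* If [c(b)] is the nearest integer to [2kb / L^2], the determinants
   [b0 c(b) - b c(b0)] are in [{-1, 0, 1}], so a third of the points [(b, c(b))]
   lie on one line, whose primitive direction is [(q, c)]. *)
Lemma close_set_rational (L k h : nat) : (0 < L)%N -> (0 < h)%N ->
  (3 * h < #|close_set L k|)%N ->
  exists q : nat, exists c : int,
    [/\ (0 < q)%N, (h * q < L)%N & h%:Z * `|(2 * k * q)%N%:Z - c * L%:Z ^+ 2| <= 2 * L%:Z].
Proof.
move=> L0 h0 hc; set P := close_set L k in hc *.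
have cP b : {c : int | b \in P -> `|(2 * k * b)%N%:Z - c * L%:Z ^+ 2| <= L%:Z}.
  apply: cid; have [/[!inE] /(close_multP _ L0) [c hb]|nb] := boolP (b \in P).
    by exists c.
  by exists 0.
pose c b := sval (cP b); have hP b : b \in P -> `|(2 * k * b)%N%:Z - c b * L%:Z ^+ 2| <= L%:Z := svalP (cP b).
(* The point 0 always lies in [P], so a nonzero one is taken among the others. *)
have [b0 b0P b00] : exists2 b0, b0 \in P & (0 < b0)%N.
  pose z : 'I_L := Ordinal L0.
  have zP : z \in P by rewrite inE /close_mult muln0 mod0n.
  have /card_gt0P[b] : (0 < #|P :\ z|)%N.
    by move: hc; rewrite (cardsD1 z P) zP add1n ltnS; apply: leq_trans; rewrite muln_gt0.
  rewrite !inE => /andP[bz bP]; exists b; first by rewrite inE.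
  by rewrite lt0n; apply: contraNneq bz => b0; apply/eqP/val_inj.
pose D (b : 'I_L) := b0%:Z * c b - b%:Z * c b0.
have DP b : b \in P -> -1 <= D b <= 1.
  move=> bP; have hb := hP b bP; have hb0 := hP b0 b0P.
  (* [L^2] times the determinant is a combination of two errors, of size less than [2 L^2]. *)
  have e : L%:Z ^+ 2 * D b = b%:Z * ((2 * k * b0)%N%:Z - c b0 * L%:Z ^+ 2)
     - b0%:Z * ((2 * k * b)%N%:Z - c b * L%:Z ^+ 2).
    by rewrite /D !PoszM; ring.
  move: e hb hb0; set x := (_ - c b0 * _); set y := (_ - c b * _) => e hb hb0.
  have bd (a : 'I_L) (z : int) : `|z| <= L%:Z -> `|a%:Z * z| <= (L%:Z - 1) * L%:Z.
    move=> hz; rewrite normrM ler_pM // ger0_norm //; have := ltn_ord a; lia.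
  have := bd b _ hb0; have := bd b0 _ hb; move: e.
  move: (b%:Z * x) (b0%:Z * y) => X Y; rewrite expr2 => e h1 h2.
  have LL : 0 < L%:Z * L%:Z by rewrite mulr_gt0.
  have h3 : `|L%:Z * L%:Z * D b| < 2 * (L%:Z * L%:Z) by rewrite e; lia.
  have : `|D b| < 2 by move: h3; rewrite normrM gtr0_norm // mulrC ltr_pM2r.
  lia.
have [t ht] : exists t : int, (h < #|P :&: [set b | D b == t]|)%N.
  apply: contrapT => H.
  have Ht (t : int) : (#|P :&: [set b | D b == t]| <= h)%N.
    by rewrite leqNgt; apply/negP => ?; apply: H; exists t.
  have : P \subset (P :&: [set b | D b == -1]) :|: (P :&: [set b | D b == 0]) :|: (P :&: [set b | D b == 1]).
    apply/fintype.subsetP => b bP; have := DP b bP; rewrite !inE.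
    move: (bP); rewrite inE => -> /=; lia.
  move=> /subset_leq_card hs; move: hc; apply/negP; rewrite -leqNgt.
  apply: leq_trans hs _; apply: leq_trans (leq_card_setU _ _) _.
  have -> : (3 * h = h + h + h)%N by lia.
  apply: leq_add; last exact: Ht.
  apply: leq_trans (leq_card_setU _ _) _; apply: leq_add; exact: Ht.
set A := P :&: _ in ht.
pose g := gcdz b0%:Z (c b0).
have g0 : g != 0 by rewrite gcdz_eq0 negb_and; apply/orP; left; rewrite eqz_nat -lt0n.
have gp : 0 < g by rewrite lt_def g0.
pose q := (b0%:Z %/ g)%Z; pose c0 := (c b0 %/ g)%Z.
have qE : b0%:Z = q * g by rewrite divzK // dvdz_gcdl.
have cE : c b0 = c0 * g by rewrite divzK // dvdz_gcdr.
have cop : coprimez q c0.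
  have /eqP : gcdz q c0 * g = g.
    by rewrite -[X in _ * X]gez0_abs ?(ltW gp) // mulz_gcdl -qE -cE.
  by rewrite -[X in _ == X]mul1r (inj_eq (mulIf g0)).
have q0 : 0 < q by rewrite -(pmulr_lgt0 _ gp) -qE ltz_nat.
pose qn := `|q|%N; have qnE : qn%:Z = q by rewrite /qn gez0_abs // ltW.
have diff x y : x \in A -> y \in A -> exists j : int,
    x%:Z - y%:Z = j * q /\ c x - c y = j * c0.
  rewrite !inE => /andP[_ /eqP Dx] /andP[_ /eqP Dy].
  have e : q * (c x - c y) = (x%:Z - y%:Z) * c0.
    apply: (mulIf g0); rewrite mulrAC -qE -[RHS]mulrA -cE.
    by move: Dx Dy; rewrite /D; lia.
  have /dvdzP[j je] : (q %| x%:Z - y%:Z)%Z.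
    by rewrite -(Gauss_dvdzl _ cop); apply/dvdzP; exists (c x - c y); rewrite -e mulrC.
  exists j; split => //; apply: (mulfI (lt0r_neq0 q0)); rewrite e je; ring.
(* Points of [A] are congruent modulo [q]; if they spanned less than [h q], division by [q] would
   embed [A] into at most [h] values. *)
have [x [y [xA yA xy]]] : exists x y : 'I_L, [/\ x \in A, y \in A & (h * qn <= x - y)%N].
  apply: contrapT => H.
  have qn0 : (0 < qn)%N by lia.
  pose f (x : 'I_L) : 'I_L := Ordinal (leq_ltn_trans (leq_div x qn) (ltn_ord x)).
  have /card_le_spread : forall x y, x \in f @: A -> y \in f @: A -> (x <= y + h.-1)%N.
    move=> _ _ /imsetP[x xA ->] /imsetP[y yA ->] /=; rewrite leqNgt; apply/negP => xy.
    apply: H; exists x, y; split => //.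
    have [j [jE _]] := diff x y xA yA.
    have := divn_eq x qn; have := divn_eq y qn.
    have : (x %% qn = y %% qn)%N.
      apply/eqP; rewrite -eqz_nat -!modz_nat eqz_mod_dvd; apply/dvdzP; exists j.
      by rewrite qnE.
    move: (x %/ qn)%N (y %/ qn)%N (y %% qn)%N xy => a b r xy -> -> ->; nia.
  rewrite card_in_imset ?prednK // => [|x y xA yA /(congr1 val) /= fxy]; first by rewrite leqNgt ht.
  have [j [jE _]] := diff x y xA yA.
  apply/val_inj => /=; rewrite (divn_eq x qn) (divn_eq y qn) fxy; congr (_ + _)%N.
  apply/eqP; rewrite -eqz_nat -!modz_nat eqz_mod_dvd; apply/dvdzP; exists j.
  by rewrite qnE.
have [j [jE jc]] := diff x y xA yA.
exists qn, c0; split; [by lia|by have := ltn_ord x; lia|].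
have xP : x \in P by move: xA; rewrite inE => /andP[].
have yP : y \in P by move: yA; rewrite inE => /andP[].
(* The errors at [x] and [y] differ by [j] times the error at [q], so the latter gains the factor
   [h]. *)
have hj : h%:Z <= j.
  rewrite -(ler_pM2r q0) -jE -qnE -PoszM; move: xy; case: (leqP y x) => yx; first by rewrite subzn.
  by have := muln_gt0 h qn; lia.
have := hP x xP; have := hP y yP.
have e : (2 * k * x)%N%:Z - c x * L%:Z ^+ 2 - ((2 * k * y)%N%:Z - c y * L%:Z ^+ 2) =
   j * ((2 * k * qn)%N%:Z - c0 * L%:Z ^+ 2).
  rewrite !PoszM qnE.
  have -> : c x = j * c0 + c y by rewrite -jc subrK.
  have -> : x%:Z = j * q + y%:Z by rewrite -jE subrK.
  by ring.
move: e; move: (_ - c x * _) (_ - c y * _) (_ - c0 * _) => u v w e hv hu.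
have : `|j * w| <= 2 * L%:Z by rewrite -e; lia.
rewrite normrM ger0_norm; last by lia.
by apply: le_trans; rewrite ler_wpM2r.
Qed.

(** A major arc: [k / L^2] lies within [1 / (h q L)] of [c / (2 q)]. *)
Definition rational_arc (L h q c : nat) : {set 'I_(L ^ 2)} :=
  [set k : 'I_(L ^ 2) | h%:Z * `|(2 * k * q)%N%:Z - c%:Z * L%:Z ^+ 2| <= 2 * L%:Z].

(** The arc has length [2 L / (h q)]; the extra 1 in the count of its integers costs [h q < L]. *)
Lemma card_rational_arc L h q c : (0 < h)%N -> (0 < q)%N -> (h * q < L)%N ->
  (h * q * #|rational_arc L h q c| <= 3 * L)%N.
Proof.
move=> h0 q0 hq; have hq0 : (0 < h * q)%N by rewrite muln_gt0 h0.
have H : (#|rational_arc L h q c| <= (2 * L %/ (h * q)).+1)%N.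
  apply: card_le_spread => x y; rewrite !inE => hx hy.
  rewrite -leq_subLR leq_divRL //.
  have [xy|xy] := leqP x y; first by move: xy; rewrite -subn_eq0 => /eqP ->.
  have : (h%:Z * ((2 * x * q)%N%:Z - (2 * y * q)%N%:Z)) <= 4 * L%:Z.
    move: hx hy; move: (c%:Z * _) => z; have hn t : h%:Z * `|t| = `|h%:Z * t| by rewrite normrM ger0_norm.
    rewrite !hn !mulrBr; lia.
  move: xy => /ltnW xy; rewrite -lez_nat !PoszM -subzn //.
  have -> : h%:Z * ((2 * x * q)%N%:Z - (2 * y * q)%N%:Z) = 2 * ((x%:Z - y%:Z) * (h%:Z * q%:Z)).
    by rewrite !PoszM; ring.
  by move: (_ * (h%:Z * _)) => z; lia.
apply: (@leq_trans (h * q * (2 * L %/ (h * q)).+1)); first by rewrite leq_mul2l H orbT.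
by rewrite mulnS; have := leq_divM (2 * L) (h * q); rewrite mulnC; lia.
Qed.

(** Union bound over the arcs. Each [q < L / h] has [2 q + 1 <= 3 q] arcs of at most [3 L / (h q)]
    elements, hence contributes at most [9 L / h]. *)
Lemma card_close_level L h : (2 < L)%N -> (0 < h)%N ->
  (h ^ 2 * #|[set k : 'I_(L ^ 2) | 3 * h < #|close_set L k|]%N| <= 9 * L ^ 2)%N.
Proof.
move=> L2 h0.
pose Q := [pred q : 'I_L | (0 < q)%N && (h * q < L)%N].
apply: (@leq_trans (h ^ 2 * \sum_(q in Q) \sum_(c < (2 * q).+1) #|rational_arc L h q c|)).
  rewrite leq_mul2l; apply/orP; right.
  under eq_bigr do under eq_bigr do rewrite -sum1_card big_mkcond /=.
  under eq_bigr do rewrite exchange_big /=.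
  rewrite exchange_big /= -sum1_card big_mkcond; apply: leq_sum => k _.
  rewrite inE; case: ifP => // hk.
  have [|q [c [q0 hq hc]]] := close_set_rational _ h0 hk; first by lia.
  have qL : (q < L)%N by nia.
  (* The error [2 L] is less than [L^2] as [L > 2], which forces [0 <= c <= 2 q]. *)
  have [cn [cE cb]] : exists cn : nat, c = cn%:Z /\ (cn < (2 * q).+1)%N.
    have hc' : `|(2 * k * q)%N%:Z - c * L%:Z ^+ 2| <= 2 * L%:Z.
      apply: le_trans hc; rewrite ler_peMl //; lia.
    have kM : k%:Z <= L%:Z ^+ 2 - 1.
      have := ltn_ord k; rewrite -[L%:Z]natz -natrX natz; lia.
    have LM : 2 * L%:Z < L%:Z ^+ 2 by rewrite expr2; nia.
    move: kM LM hc'; move: (L%:Z ^+ 2) => M kM LM hc'.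
    have k0 : 0 <= (2 * k * q)%N%:Z by [].
    have kq : (2 * k * q)%N%:Z <= 2 * q%:Z * M by rewrite !PoszM; nia.
    exists `|c|%N; have c0 : 0 <= c by nia.
    by split; [lia|nia].
  rewrite (bigD1 (Ordinal qL)) /=; last by rewrite inE /= q0.
  rewrite (bigD1 (Ordinal cb)) //= inE -cE hc; lia.
have -> : (h ^ 2 * \sum_(q in Q) \sum_(c < (2 * q).+1) #|rational_arc L h q c| =
  h * \sum_(q in Q) h * \sum_(c < (2 * q).+1) #|rational_arc L h q c|)%N.
  by rewrite -big_distrr /= mulnA.
apply: (@leq_trans (h * \sum_(q in Q) (9 * L))).
  rewrite leq_mul2l; apply/orP; right; apply: leq_sum => q /andP[q0 hq].
  rewrite -(@leq_pmul2r q) //.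
  apply: (@leq_trans (\sum_(c < (2 * q).+1) (3 * L))).
    rewrite mulnAC big_distrr /=; apply: leq_sum => c _; exact: card_rational_arc.
  by rewrite sum_nat_const card_ord; nia.
rewrite sum_nat_const mulnA.
suff : (h * #|Q| <= L)%N.
  move: #|Q| => n /(leq_mul (leqnn (9 * L))).
  have -> : (h * n * (9 * L) = 9 * L * (h * n))%N by lia.
  by rewrite -(mulnA 9 L L) mulnn.
have Qc : (#|Q| <= (L.-1 %/ h))%N.
  rewrite -[X in (_ <= X)%N](card_ord (L.-1 %/ h)).
  have [n0|n0] := posnP (L.-1 %/ h).
    rewrite n0 card_ord eq_card0 // => q; rewrite !inE; apply/negP => /andP[q0 hq].
    have : (h <= L.-1)%N by nia.
    by rewrite -divn_gt0 // n0.
  pose f (q : 'I_L) : 'I_(L.-1 %/ h) := Ordinal (ltn_pmod q.-1 n0).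
  rewrite -(@card_in_image _ _ f) ?max_card // => x y.
  rewrite !inE => /andP[x0 hx] /andP[y0 hy] /(congr1 val) /=.
  have xb : (x <= L.-1 %/ h)%N by rewrite leq_divRL // mulnC; lia.
  have yb : (y <= L.-1 %/ h)%N by rewrite leq_divRL // mulnC; lia.
  by rewrite !modn_small; [|lia|lia] => e; apply/val_inj => /=; lia.
have := leq_divM L.-1 h; rewrite mulnC => hd.
apply: (@leq_trans (h * (L.-1 %/ h))); first by rewrite leq_mul2l Qc orbT.
lia.
Qed.

(** * Doob's inequality and the maximal inequality on boxes *)

Section Doob.
Context (R : realType) (T : finType) (I : eqType) (cell : nat -> T -> I).
Context (F : T -> R) (P : R).
Context (cellS : forall n x y, cell n.+1 x = cell n.+1 y -> cell n x = cell n y).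
Context (F0 : forall x, 0 <= F x).

(** Conditional expectation of [F] on the level-[n] cells, for the uniform measure. By [cellS] the
    cells are refined as [n] grows, so this is a martingale. *)
Definition cell_avg n x : R :=
  (\sum_(y | cell n y == cell n x) F y) / #|[pred y | cell n y == cell n x]|%:R.

Fixpoint cell_max n x : R :=
  if n is n'.+1 then Num.max (cell_max n' x) (cell_avg n x) else cell_avg 0 x.

Lemma cell_avg_ge0 n x : 0 <= cell_avg n x.
Proof. by rewrite divr_ge0 // sumr_ge0. Qed.

Lemma cell_max_ge0 n x : 0 <= cell_max n x.
Proof. by case: n => [|n] /=; rewrite ?le_max cell_avg_ge0 ?orbT. Qed.

Lemma cell_avgE n x y : cell n x = cell n y -> cell_avg n x = cell_avg n y.
Proof. by move=> e; rewrite /cell_avg e. Qed.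

Lemma cell_maxE n x y : cell n x = cell n y -> cell_max n x = cell_max n y.
Proof.
elim: n => [|n IH] e /=; first exact: cell_avgE.
by rewrite (IH (cellS e)) (cell_avgE e).
Qed.

Lemma sum_cell_avg n (h : T -> R) :
  (forall x y, cell n x = cell n y -> h x = h y) ->
  \sum_x F x * h x = \sum_x cell_avg n x * h x.
Proof.
move=> hE; rewrite /cell_avg.
under [RHS]eq_bigr do rewrite mulrAC big_distrl /= big_distrl /= big_mkcond.
rewrite exchange_big /=; apply: eq_bigr => y _.
rewrite -big_mkcond /=.
have -> : \sum_(x | cell n y == cell n x) F y * h x / #|[pred z | cell n z == cell n x]|%:R
  = \sum_(x in [pred z | cell n z == cell n y]) F y * h y / #|[pred z | cell n z == cell n y]|%:R.
  apply: eq_big => [x|x /eqP e]; first by rewrite inE eq_sym.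
  by rewrite e (hE x y).
rewrite sumr_const -(mulr_natr (_ / _)) divfK //.
by rewrite pnatr_eq0 -lt0n; apply/card_gt0P; exists y; rewrite inE.
Qed.

(** Young's inequality with exponents [P] and [P / (P - 1)]. *)
Lemma powR_conj (a b : R) : 1 < P -> 0 <= a -> 0 <= b ->
  b * a `^ (P - 1) <= b `^ P / P + a `^ P * ((P - 1) / P).
Proof.
move=> P1 a0 b0.
have Pp : 0 < P := lt_trans ltr01 P1.
have Pq : 0 < P / (P - 1) by rewrite divr_gt0 //; lra.
apply: le_trans (conjugate_powR b0 (powR_ge0 a (P - 1)) Pp Pq _) _.
  by field; lra.
rewrite -powRrM lerD2l.
have -> : (P - 1) * (P / (P - 1)) = P by field; lra.
by rewrite invf_div.
Qed.

(** Induction on [n]. The increment of [cell_max ^ (P - 1)] is constant on cells of level [n + 1],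
    so [F] may be replaced by its average there. Where the maximum grows from [a], that average [b]
    is its new value, and Young's inequality gives [b (b^(P-1) - a^(P-1)) >= (P - 1) / P (b^P -
    a^P)]. *)
Lemma doob_lower n : 1 < P ->
  (P - 1) / P * \sum_x cell_max n x `^ P <= \sum_x F x * cell_max n x `^ (P - 1).
Proof.
move=> P1; have Pp : 0 < P := lt_trans ltr01 P1.
elim: n => [|n IH].
  rewrite (@sum_cell_avg 0); last by move=> x y e; rewrite (cell_maxE e).
  rewrite mulr_sumr; apply: ler_sum => x _ /=.
  rewrite mulr_powRB1 ?cell_avg_ge0 // ler_piMl ?powR_ge0 //.
  by rewrite ler_pdivrMr //; lra.
have split x : F x * cell_max n.+1 x `^ (P - 1) = F x * cell_max n x `^ (P - 1) +
    F x * (cell_max n.+1 x `^ (P - 1) - cell_max n x `^ (P - 1)) by ring.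
rewrite (eq_bigr _ (fun x _ => split x)) big_split.
rewrite (@sum_cell_avg n.+1 (fun x => cell_max n.+1 x `^ (P - 1) - cell_max n x `^ (P - 1))); last first.
  by move=> x y e; rewrite (cell_maxE e) (cell_maxE (cellS e)).
apply: le_trans (lerD IH (lexx _)).
rewrite [leRHS]addrC -lerBlDr -mulrBr -sumrB mulr_sumr.
apply: ler_sum => x _ /=; have [le|lt] := leP (cell_avg n.+1 x) (cell_max n x).
  by rewrite !subrr !mulr0.
set a := cell_max n x in lt *; set b := cell_avg n.+1 x in lt *.
have a0 : 0 <= a := cell_max_ge0 _ _; have b0 : 0 <= b := cell_avg_ge0 _ _.
have := powR_conj P1 a0 b0; rewrite [X in _ -> _ <= X]mulrBr mulr_powRB1 //.
move: (b `^ P) (a `^ P) (b * _) => u v w h.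
have -> : (P - 1) / P * (u - v) = u - (u / P + v * ((P - 1) / P)) by field; lra.
lra.
Qed.

(** Young's inequality for the product of [2 F] and [M^(P-1) / 2], [M] being the maximum, bounds the
    right side of [doob_lower]; as [2^(- P / (P - 1)) <= 1/2], the part in [M^P] is absorbed. *)
Lemma doob n : 1 < P ->
  \sum_x cell_max n x `^ P <= 2 `^ (P + 1) / (P - 1) * \sum_x F x `^ P.
Proof.
move=> P1; have Pp : 0 < P := lt_trans ltr01 P1.
have Pq : 0 < P / (P - 1) by rewrite divr_gt0 //; lra.
set S := \sum_x cell_max n x `^ P.
have S0 : 0 <= S by apply: sumr_ge0 => x _; exact: powR_ge0.
have key : (P - 1) / P * S <= 2 `^ P / P * \sum_x F x `^ P + 2^-1 * ((P - 1) / P * S).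
  apply: le_trans (doob_lower n P1) _.
  rewrite !mulr_sumr -big_split; apply: ler_sum => x _ /=.
  have -> : F x * cell_max n x `^ (P - 1) = 2 * F x * (cell_max n x `^ (P - 1) / 2).
    by field.
  have M0 := cell_max_ge0 n x.
  apply: le_trans (conjugate_powR _ _ Pp Pq _) _.
  - by rewrite mulr_ge0.
  - by rewrite divr_ge0 // powR_ge0.
  - by field; lra.
  rewrite !powRM ?powR_ge0 ?invr_ge0 // -[_ / P]mulrA [X in _ * X]mulrC mulrA lerD2l.
  rewrite -powRrM.
  have -> : (P - 1) * (P / (P - 1)) = P by field; lra.
  have -> : cell_max n x `^ P * 2^-1 `^ (P / (P - 1)) / (P / (P - 1)) =
    2^-1 `^ (P / (P - 1)) * ((P - 1) / P * cell_max n x `^ P).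
    by move: (2^-1 `^ _) (_ `^ P) => u v; field; lra.
  apply: ler_wpM2r; first by rewrite mulr_ge0 ?powR_ge0 // divr_ge0 //; lra.
  have h2 : (0 < (2^-1 : R) <= 1)%R by apply/andP; split; lra.
  by apply: (ge1r_powR h2); rewrite ler_pdivlMr; lra.
have -> : 2 `^ (P + 1) = 2 * 2 `^ P.
  rewrite powRD; last by apply/implyP => _; rewrite pnatr_eq0.
  by rewrite powRr1 ?ler0n // mulrC.
move: key; move: (2 `^ P) (\sum_x F x `^ P) => u v key.
rewrite -(ler_pM2l (_ : 0 < (P - 1) / P / 2)); last by rewrite !divr_gt0 //; lra.
have -> : (P - 1) / P / 2 * (2 * u / (P - 1) * v) = u / P * v by field; lra.
have -> : (P - 1) / P / 2 * S = ((P - 1) / P * S) / 2 by rewrite mulrAC.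
move: key; move: ((P - 1) / P * S) (u / P * v) => w z; lra.
Qed.

End Doob.

Lemma cell_avg_le_max (R : realType) (T : finType) (I : eqType) (cell : nat -> T -> I)
  (F : T -> R) (m n : nat) (x : T) : (m <= n)%N ->
  cell_avg cell F m x <= cell_max cell F n x.
Proof.
elim: n => [|n IH]; first by rewrite leqn0 => /eqP ->.
rewrite leq_eqVlt ltnS => /orP[/eqP->|/IH h] /=; first by rewrite le_max lexx orbT.
by rewrite le_max h.
Qed.

(* Approximately one third of [2 ^ k], compatibly for all [k]: an interval of
   length [2r] meeting a boundary of the grid of mesh [8r] stays inside a cell
   once translated by [third_shift k]. *)
Fixpoint third_shift (k : nat) : nat :=
  if k is k'.+1 then (third_shift k' + (~~ odd k') * 2 ^ k')%N else 0%N.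

Lemma third_shift_lt k : (third_shift k < 2 ^ k)%N.
Proof. by elim: k => // k IH /=; rewrite expnS; case: odd; lia. Qed.

Lemma third_shift_mod k m : (k <= m)%N -> (third_shift m %% 2 ^ k = third_shift k)%N.
Proof.
move=> km; rewrite -(subnK km); elim: (m - k)%N => [|n IH].
  by rewrite add0n modn_small // third_shift_lt.
rewrite addSn /= -modnDmr -modnMmr -IH.
have -> : (2 ^ (n + k) %% 2 ^ k = 0)%N by rewrite expnD modnMl.
by rewrite muln0 mod0n addn0.
Qed.

Lemma third_shift_bounds j :
  (2 * 2 ^ j <= third_shift j.+3 < 6 * 2 ^ j)%N.
Proof.
have := third_shift_lt j; rewrite /= !expnS; case: odd => /=; lia.
Qed.

Lemma eq_divn_near (x y r : nat) : (r <= x %% (8 * r) < 7 * r)%N ->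
  (x <= y + r)%N -> (y <= x + r)%N -> (y %/ (8 * r) = x %/ (8 * r))%N.
Proof.
move=> /andP[h1 h2] h3 h4; have r0 : (0 < r)%N by case: r h1 h2 {h3 h4}.
have := divn_eq x (8 * r); move: (x %/ (8 * r))%N (x %% (8 * r))%N h1 h2 => q s h1 h2 xE.
have -> : y = (q * (8 * r) + (y - q * (8 * r)))%N by lia.
by rewrite divnMDl ?divn_small ?addn0; lia.
Qed.

(** A residue within [r] of a multiple of [8 r] is moved by a shift between [2 r] and [6 r] to
    distance at least [r] from all multiples. *)
Lemma shifted_cell (x j m : nat) (r := (2 ^ j)%N) : (j.+3 <= m)%N ->
  (r <= x %% (8 * r) < 7 * r)%N || (r <= (x + third_shift m) %% (8 * r) < 7 * r)%N.
Proof.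
move=> jm; have r0 : (0 < r)%N by rewrite expn_gt0.
have rE : (8 * r = 2 ^ j.+3)%N by rewrite !expnS; lia.
rewrite -modnDm rE third_shift_mod // -rE.
have := third_shift_bounds j; rewrite -/r.
move: (third_shift _) => s sb.
have := ltn_pmod x (_ : 0 < 8 * r)%N; move: (x %% _)%N => y yb.
have yr : (y < 8 * r)%N by apply: yb; lia.
have [ys|ys] := ltnP (y + s) (8 * r); first by rewrite modn_small //; lia.
have -> : ((y + s) %% (8 * r) = y + s - 8 * r)%N.
  by rewrite -{1}(subnK ys) modnDr modn_small //; lia.
lia.
Qed.

(** * Shifted dyadic grids and the maximal function on a box *)

Section HardyLittlewood.
Context (R : realType) (d B m : nat).
Local Notation T := {ffun 'I_d -> 'I_B}.
Context (F : T -> R).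

(** One grid for each choice [e] of the coordinates to shift; its cells have side [2^(m - n)] at
    level [n]. *)
Definition grid (e : {ffun 'I_d -> bool}) (n : nat) (x : T) : {ffun 'I_d -> nat} :=
  [ffun i => ((x i + e i * third_shift m) %/ 2 ^ (m - n))%N].

Definition near_box (r : nat) (x : T) : {pred T} :=
  [pred y : T | [forall i, (x i <= y i + r)%N && (y i <= x i + r)%N]].

Lemma gridS e n x y : grid e n.+1 x = grid e n.+1 y -> grid e n x = grid e n y.
Proof.
move=> /ffunP h; apply/ffunP => i; move: (h i); rewrite !ffunE.
have [mn|nm] := leqP m n.
  by have [-> ->] : (m - n = 0)%N /\ (m - n.+1 = 0)%N by lia.
have -> : (m - n = (m - n.+1) + 1)%N by lia.
by rewrite expnD !divnMA => ->.
Qed.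

Lemma card_grid_cell e n x :
  (#|[pred y | grid e n y == grid e n x]| <= (2 ^ (m - n)) ^ d)%N.
Proof.
have p0 : (0 < 2 ^ (m - n))%N by rewrite expn_gt0.
pose f (y : T) : {ffun 'I_d -> 'I_(2 ^ (m - n))} :=
  [ffun i => Ordinal (ltn_pmod (y i + e i * third_shift m) p0)].
rewrite -[X in (_ <= _ ^ X)%N](card_ord d) -[X in (_ <= X ^ _)%N](card_ord (2 ^ (m - n))).
rewrite -card_ffun -(@card_in_image _ _ f) ?max_card // => y z.
rewrite !inE => /eqP yx /eqP zx /ffunP fyz; apply/ffunP => i; apply/val_inj => /=.
move: (fyz i) => /(congr1 val); rewrite !ffunE /= => e1.
have : grid e n y i = grid e n z i by rewrite yx zx.
rewrite !ffunE => e2.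
have := divn_eq (y i + e i * third_shift m) (2 ^ (m - n)).
rewrite e2 e1 -divn_eq; lia.
Qed.

Context (F0 : forall x, 0 <= F x).

(** Shifting exactly those coordinates where [x] is within [r] of a boundary of the mesh [8 r] puts
    the cube of radius [r] about [x] inside a single cell of side [8 r]. *)
Lemma near_sum_le (x : T) (j : nat) : (j.+3 <= m)%N ->
  \sum_(y in near_box (2 ^ j) x) F y <=
  ((8 * 2 ^ j) ^ d)%N%:R * \sum_e cell_max (grid e) F m x.
Proof.
move=> jm; set r := (2 ^ j)%N.
have rE : (8 * r = 2 ^ (m - (m - j.+3)))%N by rewrite subKn // /r !expnS; lia.
pose e : {ffun 'I_d -> bool} := [ffun i => ~~ (r <= x i %% (8 * r) < 7 * r)%N].
have near y : y \in near_box r x -> grid e (m - j.+3) y = grid e (m - j.+3) x.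
  move=> /forallP h; apply/ffunP => i; rewrite !ffunE -rE.
  have /andP[h1 h2] := h i; have := shifted_cell (x i) jm; rewrite -/r.
  case: (boolP (r <= x i %% (8 * r) < 7 * r)%N) => xi /=; first by move=> _; apply: eq_divn_near; rewrite ?mul0n ?addn0.
  by move=> h3; apply: eq_divn_near; rewrite ?mul1n //; lia.
apply: (@le_trans _ _ (((8 * r) ^ d)%N%:R * cell_avg (grid e) F (m - j.+3) x)).
  set A := [pred y | grid e (m - j.+3) y == grid e (m - j.+3) x].
  have A0 : (0 < #|A|)%N by apply/card_gt0P; exists x; rewrite inE.
  apply: (@le_trans _ _ (#|A|%:R * cell_avg (grid e) F (m - j.+3) x)).
    rewrite mulrC divfK ?pnatr_eq0 -?lt0n //.
    rewrite big_mkcond [leRHS]big_mkcond; apply: ler_sum => y _.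
    case: ifPn => [/near ->|_]; first by rewrite eqxx.
    by case: ifP.
  rewrite ler_wpM2r ?cell_avg_ge0 // ler_nat.
  by rewrite rE card_grid_cell.
rewrite ler_wpM2l // (le_trans (cell_avg_le_max _ _ _ (leq_subr j.+3 m))) //.
rewrite (bigD1 e) //= lerDl; apply: sumr_ge0 => e' _; exact: cell_max_ge0.
Qed.

(** Doob's inequality is applied to each of the [2^d] grids. Their maxima sum to at most [2^d M],
    [M] being the largest, and [M^P] is at most the sum of their [P]-th powers. *)
Lemma maximal_box (P : R) (J : nat) : 1 < P -> (J + 2 <= m)%N ->
  \sum_x (\big[Num.max/0]_(j < J)
    (((2 ^ j) ^ d)%N%:R^-1 * \sum_(y in near_box (2 ^ j) x) F y)) `^ P <=
  (8 ^ d * 2 ^ d)%N%:R `^ P * 2 ^+ d * (2 `^ (P + 1) / (P - 1)) * \sum_x F x `^ P.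
Proof.
move=> P1 Jm; have P0 : 0 <= P by lra.
apply: (@le_trans _ _ (\sum_x (8 ^ d * 2 ^ d)%N%:R `^ P * \sum_e cell_max (grid e) F m x `^ P)).
  apply: ler_sum => x _.
  pose M := \big[Num.max/0]_e cell_max (grid e) F m x.
  have cM e : cell_max (grid e) F m x <= M by rewrite /M (bigD1 e) //= le_max lexx.
  have M0 : 0 <= M by rewrite /M; apply: (big_ind (fun a : R => 0 <= a)) => // [a b ha hb|e _]; rewrite ?le_max ?ha ?cell_max_ge0.
  apply: (@le_trans _ _ (((8 ^ d * 2 ^ d)%N%:R * M) `^ P)).
    apply: ge0_ler_powR => //; rewrite ?nnegrE.
    - by apply: (big_ind (fun a : R => 0 <= a)) => // [a b ha hb|j _]; rewrite ?le_max ?ha // mulr_ge0 // ?invr_ge0 // sumr_ge0.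
    - by rewrite mulr_ge0.
    apply: (big_ind (fun a : R => a <= _)) => [|a b ha hb|j _]; first by rewrite mulr_ge0.
      by rewrite ge_max ha.
    have jm : (j.+3 <= m)%N by have := ltn_ord j; lia.
    rewrite ler_pdivrMl ?ltr0n ?expn_gt0 ?expn_gt0 //.
    apply: le_trans (near_sum_le x jm) _.
    rewrite mulrA -natrM [(_ * (8 ^ d * _))%N]mulnA -expnMn [(2 ^ j * 8)%N]mulnC natrM -mulrA ler_wpM2l //.
    apply: le_trans (ler_sum _ (fun e _ => cM e)) _.
    by rewrite sumr_const card_ffun card_bool card_ord mulr_natl.
  rewrite powRM // ler_wpM2l ?powR_ge0 //.
  have S0 : 0 <= \sum_e cell_max (grid e) F m x `^ P.
    by apply: sumr_ge0 => e _; exact: powR_ge0.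
  suff [] : 0 <= M /\ M `^ P <= \sum_e cell_max (grid e) F m x `^ P by [].
  rewrite /M; apply: (big_ind (fun a => 0 <= a /\ a `^ P <= \sum_e cell_max (grid e) F m x `^ P)) => [|a b [ha1 ha2] [hb1 hb2]|e _].
  - by rewrite powR0 //; lra.
  - by rewrite le_max ha1; split => //; case: (leP a b).
  - split; first exact: cell_max_ge0.
    by rewrite (bigD1 e) //= lerDl; apply: sumr_ge0 => e' _; exact: powR_ge0.
rewrite -mulr_sumr -!mulrA ler_wpM2l ?powR_ge0 // exchange_big /=.
rewrite [leRHS]mulrA.
have -> : 2 ^+ d = #|{ffun 'I_d -> bool}|%:R :> R by rewrite card_ffun card_bool card_ord natrX.
rewrite -[leRHS]mulrA mulr_natl -sumr_const; apply: ler_sum => e _.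
rewrite mulrA; apply: doob => // n x y; exact: gridS.
Qed.

End HardyLittlewood.

Local Open Scope complex_scope.
Local Notation normc := ComplexField.Normc.normc.

(** * Smoothed Weyl sums and their moments *)

Section Normc.
Context {R : rcfType}.
Implicit Types z : R[i].

Lemma normc_ge0 z : 0 <= normc z.
Proof. by case: z => a b; exact: sqrtr_ge0. Qed.

Lemma normc_natr n : normc (n%:R : R[i]) = n%:R.
Proof.
by rewrite -[n%:R](rmorph_nat (real_complex R)) /= expr0n addr0 sqrtr_sqr ger0_norm.
Qed.

Lemma normc_real (x : R) : 0 <= x -> normc x%:C = x.
Proof. by move=> x0; rewrite /= expr0n addr0 sqrtr_sqr ger0_norm. Qed.

Lemma normc_sum (I : Type) (r : seq I) (P : pred I) (F : I -> R[i]) :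
  normc (\sum_(i <- r | P i) F i) <= \sum_(i <- r | P i) normc (F i).
Proof.
elim/big_rec2: _ => [|i x z _ h]; first by rewrite ComplexField.Normc.normc0.
by apply: le_trans (le_normcD _ _) _; rewrite lerD2l.
Qed.

Lemma normcX z n : normc (z ^+ n) = normc z ^+ n.
Proof.
elim: n => [|n IH]; first by rewrite !expr0 ComplexField.Normc.normc1.
by rewrite !exprS ComplexField.Normc.normcM IH.
Qed.

Lemma sqr_normcC z : (normc z ^+ 2)%:C = z * (z^*)%C.
Proof.
case: z => a b; rewrite [normc _]/= sqr_sqrtr ?addr_ge0 ?sqr_ge0 //.
by simpc; congr (_ +i* _); ring.
Qed.

Lemma conjc_sum (I : finType) (F : I -> R[i]) :
  (conjc (\sum_i F i) = \sum_i conjc (F i)).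
Proof. exact: rmorph_sum. Qed.

End Normc.

Section Exp.
Context {R : realType}.

Definition expi (x : R) : R[i] := cos x +i* sin x.

Lemma expiD x y : expi (x + y) = expi x * expi y.
Proof. by rewrite /expi cosD sinD; simpc; congr (_ +i* _); ring. Qed.

Lemma expi0 : expi 0 = 1.
Proof. by rewrite /expi cos0 sin0. Qed.

Lemma normc_expi x : normc (expi x) = 1.
Proof. by rewrite /= cos2Dsin2 sqrtr1. Qed.

Lemma conj_expi x : (expi x)^* = expi (- x).
Proof. by rewrite /expi /= cosN sinN. Qed.

Lemma expi_pi2 : expi (pi *+ 2) = 1.
Proof. by rewrite /expi cos2pi sin2pi. Qed.

Definition exp_root (L : nat) (j : int) : R[i] :=
  expi (pi *+ 2 * j%:~R / (L ^ 2)%N%:R).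

Lemma eeD L a b : exp_root L (a + b) = exp_root L a * exp_root L b.
Proof. by rewrite /exp_root intrD mulrDr mulrDl expiD. Qed.

Lemma ee0 L : exp_root L 0 = 1.
Proof. by rewrite /exp_root mulr0 mul0r expi0. Qed.

Lemma normc_ee L a : normc (exp_root L a) = 1.
Proof. exact: normc_expi. Qed.

Lemma conj_ee L a : (exp_root L a)^* = exp_root L (- a).
Proof. by rewrite /exp_root conj_expi intrN mulrN mulNr. Qed.

Lemma eeX L a n : exp_root L a ^+ n = exp_root L (a * n%:Z).
Proof.
elim: n => [|n IH]; first by rewrite expr0 mulr0 ee0.
by rewrite exprS IH -eeD; congr exp_root; rewrite intS; ring.
Qed.

Lemma ee_sum L (I : Type) (r : seq I) (P : pred I) (F : I -> int) :
  exp_root L (\sum_(i <- r | P i) F i) = \prod_(i <- r | P i) exp_root L (F i).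
Proof. by apply: (big_morph (exp_root L)); [exact: eeD|exact: ee0]. Qed.

Lemma eeM L a : (0 < L)%N -> exp_root L (a * L%:Z ^+ 2) = 1.
Proof.
move=> L0.
have e1 : exp_root L (L%:Z ^+ 2) = 1.
  rewrite /exp_root rmorphXn /= natrX -mulrA divff ?mulr1 ?expi_pi2 //.
  by rewrite expf_neq0 // pnatr_eq0 -lt0n.
have e2 n : exp_root L (n%:Z * L%:Z ^+ 2) = 1 by rewrite mulrC -eeX e1 expr1n.
case: a => n; first exact: e2.
by rewrite NegzE mulNr -conj_ee e2 conjc1.
Qed.

Lemma ee_mod L a b c : (0 < L)%N -> a = b + c * L%:Z ^+ 2 -> exp_root L a = exp_root L b.
Proof. by move=> L0 ->; rewrite eeD eeM // mulr1. Qed.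

(** If [4 r <= L^2], the bound for [2 r] gives that for [r], as [1 - z^2 = (1 - z) (1 + z)] and
    [|1 + z| <= 2]. Otherwise the cosine is nonpositive and [|1 - z| >= 1]. *)
Lemma normc_1Bee L (r : nat) : (0 < r)%N -> (2 * r <= L ^ 2)%N ->
  2 * r%:R / (L ^ 2)%N%:R <= normc (1 - exp_root L r%:Z).
Proof.
have [n] := ubnP (L ^ 2 - r)%N; elim: n r => // n IH r rn r0 rM.
have M0 : (0 < (L ^ 2)%N%:R :> R) by rewrite ltr0n; lia.
have [r4|r4] := leqP (4 * r) (L ^ 2).
  have := IH (2 * r)%N; have -> : (2 * (2 * r) = 4 * r)%N by lia.
  move=> /(_ _ _ r4) h.
  have {h} : 2 * (2 * r)%N%:R / (L ^ 2)%N%:R <= normc (1 - exp_root L (2 * r)%N%:Z) by apply: h; lia.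
  have -> : 1 - exp_root L (2 * r)%N%:Z = (1 - exp_root L r%:Z) * (1 + exp_root L r%:Z).
    rewrite PoszM [2%N%:Z * _]mulrC -eeX; ring.
  rewrite ComplexField.Normc.normcM natrM => h.
  have h1 : normc (1 + exp_root L r%:Z) <= 2.
    by apply: le_trans (le_normcD _ _) _; rewrite ComplexField.Normc.normc1 normc_ee.
  have h2 := ler_wpM2l (normc_ge0 (1 - exp_root L r%:Z)) h1.
  move: h; have -> : 2 * (2 * r%:R) / (L ^ 2)%N%:R = 2 * (2 * r%:R / (L ^ 2)%N%:R) :> R by ring.
  lra.
apply: (@le_trans _ _ 1).
  by rewrite ler_pdivrMr // mul1r -natrM ler_nat.
rewrite /exp_root /expi; set x := _ / _.
have c0 : cos x <= 0.
  rewrite -[x](subKr pi) cosB cospi sinpi mul0r addr0 mulN1r oppr_le0.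
  apply: cos_ge0_pihalf.
  have p0 := @pi_gt0 R.
  have e : x = pi * (2 * r%:R / (L ^ 2)%N%:R) by rewrite /x -[_%:~R]/(r%:R) -mulr_natr; ring.
  have h1 : 2 * r%:R / (L ^ 2)%N%:R <= 1 :> R.
    by rewrite ler_pdivrMr // mul1r -natrM ler_nat.
  have h2 : 2^-1 <= 2 * r%:R / (L ^ 2)%N%:R :> R.
    have h2 : (L ^ 2)%N%:R <= 4 * r%:R :> R by rewrite -natrM ler_nat; lia.
    rewrite ler_pdivlMr //; lra.
  rewrite e; move: h1 h2; move: (_ / _) => t h1 h2; nra.
rewrite -(ler_sqr (_ : 1 \is Num.nneg)) ?nnegrE ?normc_ge0 //.
simpc; rewrite /= sqr_sqrtr ?addr_ge0 ?sqr_ge0 //.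
have := cos2Dsin2 x; nra.
Qed.

End Exp.
Arguments expi : simpl never.
Arguments exp_root : simpl never.

Section Weyl.
Context {R : realType}.
Context (L k : nat) (L0 : (0 < L)%N).
Local Notation ee := (@exp_root R L).

Lemma normcJ (z : R[i]) : normc z^* = normc z.
Proof. by case: z => a b /=; rewrite sqrrN. Qed.

Definition geo (a : int) : R[i] := \sum_(i < L) ee (2 * k%:Z * a * i%:Z).

Lemma normc_geo_le a : normc (geo a) <= L%:R.
Proof.
apply: le_trans (normc_sum _ _ _) _.
by rewrite (eq_bigr (fun=> 1)) ?sumr_const ?card_ord // => i _; rewrite normc_ee.
Qed.

Definition geo_res (a : int) : nat := `|((2 * k%:Z * a) %% (L ^ 2)%N%:Z)%Z|%N.

Lemma geo_resP a : (geo_res a < L ^ 2)%N /\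
  exists c : int, 2 * k%:Z * a = c * L%:Z ^+ 2 + (geo_res a)%:Z.
Proof.
have M0 : (L ^ 2)%N%:Z != 0 by rewrite eqz_nat expn_eq0; case: (L) L0.
have h := modz_ge0 (2 * k%:Z * a) M0; rewrite /geo_res; split.
  by have := ltz_mod (2 * k%:Z * a) M0; lia.
exists ((2 * k%:Z * a) %/ (L ^ 2)%N%:Z)%Z; rewrite gez0_abs // [LHS](divz_eq _ (L ^ 2)%N%:Z).
by congr (_ * _ + _); rewrite -[L%:Z]natz -natrX natz.
Qed.

Lemma geo_lt_cell a : (geo_res a %/ L < L)%N.
Proof. by rewrite ltn_divLR // mulnn; case: (geo_resP a). Qed.

(** [|geo a|] is at most [L] and at most [2 / |1 - z|], [z] being the ratio. The residue is at least
    [t L], and at least [(L - t - 1) L] below [L^2]; the two terms serve the two halves of the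
    circle. *)
Lemma normc_geo_sq a (t := (geo_res a %/ L)%N) :
  normc (geo a) ^+ 2 <= 4 * L%:R ^+ 2 * (t.+1%:R ^- 2 + (L - t)%:R ^- 2).
Proof.
have [rM [c rc]] := geo_resP a; have tL := geo_lt_cell a; rewrite -/t in tL.
set r := geo_res a in rM rc t tL *.
have zE : ee (2 * k%:Z * a) = ee r%:Z by apply: (@ee_mod R L _ _ c) => //; rewrite rc addrC.
have gE : (1 - ee r%:Z) * geo a = 1 - ee r%:Z ^+ L.
  rewrite -[in RHS](expr1n _ L) subrXX; congr (_ * _); rewrite /geo.
  by apply: eq_bigr => i _; rewrite expr1n mul1r -eeX zE.
have b2 : normc (1 - ee r%:Z) * normc (geo a) <= 2.
  rewrite -ComplexField.Normc.normcM gE; apply: le_trans (le_normcD _ _) _.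
  by rewrite normcN ComplexField.Normc.normc1 eeX normc_ee.
have LR : 0 < L%:R :> R by rewrite ltr0n.
have MR : (L ^ 2)%N%:R = L%:R * L%:R :> R by rewrite natrX.
have G0 := normc_ge0 (geo a); have GL := normc_geo_le a.
have fin (s : nat) : 2 * (s * L)%N%:R / (L ^ 2)%N%:R <= normc (1 - ee r%:Z) ->
    normc (geo a) ^+ 2 <= 4 * L%:R ^+ 2 * s.+1%:R ^- 2.
  move=> h.
  have h1 : s%:R * normc (geo a) <= L%:R.
    have := ler_wpM2r G0 h; rewrite MR natrM.
    have -> : 2 * (s%:R * L%:R) / (L%:R * L%:R) * normc (geo a) =
      2 * (s%:R * normc (geo a)) / L%:R :> R by field; rewrite lt0r_neq0.
    move=> /le_trans /(_ b2); rewrite ler_pdivrMr //; lra.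
  rewrite ler_pdivlMr ?exprn_gt0 ?ltr0n // -exprMn.
  have -> : 4 * L%:R ^+ 2 = (2 * L%:R) ^+ 2 :> R by ring.
  rewrite ler_sqr ?nnegrE ?mulr_ge0 //.
  by rewrite mulrC -addn1 natrD mulrDl mul1r; lra.
have [r2|r2] := leqP (2 * r) (L ^ 2).
  apply: (@le_trans _ _ (4 * L%:R ^+ 2 * t.+1%:R ^- 2)).
    apply: fin; have [r0|r0] := posnP r.
      by rewrite /t r0 div0n mul0n mulr0 mul0r normc_ge0.
    apply: le_trans (normc_1Bee r0 r2); rewrite ler_wpM2r ?invr_ge0 //.
    by rewrite ler_wpM2l // ler_nat leq_divM.
  by rewrite ler_wpM2l ?mulr_ge0 ?exprn_ge0 // lerDl invr_ge0 exprn_ge0.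
apply: (@le_trans _ _ (4 * L%:R ^+ 2 * (L - t)%:R ^- 2)); last first.
  by rewrite ler_wpM2l ?mulr_ge0 ?exprn_ge0 // lerDr invr_ge0 exprn_ge0.
have -> : (L - t = (L - t).-1.+1)%N by rewrite prednK // subn_gt0.
apply: fin.
have -> : normc (1 - ee r%:Z) = normc (1 - ee (L ^ 2 - r)%N%:Z).
  rewrite -[RHS]normcJ; congr normc.
  have -> : (1 - ee (L ^ 2 - r)%N%:Z)^* = 1 - ee (- (L ^ 2 - r)%N%:Z) by rewrite rmorphB rmorph1 -conj_ee.
   congr (_ - _).
  apply: (@ee_mod R L _ _ 1) => //.
  rewrite -subzn ?(ltnW rM) // mul1r -[(L ^ 2)%N%:Z]natz natrX natz; ring.
have h := @normc_1Bee R L (L ^ 2 - r).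
apply: le_trans (h _ _); [|lia|lia].
rewrite ler_wpM2r ?invr_ge0 // ler_wpM2l // ler_nat.
have : (r < t.+1 * L)%N by rewrite -ltn_divLR.
have : (L ^ 2 = L * L)%N by rewrite mulnn.
move: (L ^ 2)%N => M ->; nia.
Qed.

(** Members of one cell have residues less than [L] apart, so subtracting the least member maps the
    cell into [close_set L k]. *)
Lemma card_geo_cell (j' : nat) (t : nat) :
  (#|[set j : 'I_L | geo_res (j%:Z - j'%:Z) %/ L == t]%N| <= #|close_set L k|)%N.
Proof.
set A := [set j : 'I_L | _]; have [->|[x0 x0A]] := set_0Vmem A; first by rewrite cards0.
have [x xA xmin] := @arg_minnP _ x0 (mem A) (fun i : 'I_L => val i) x0A.
pose f (y : 'I_L) : 'I_L := Ordinal (leq_ltn_trans (leq_subr x y) (ltn_ord y)).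
rewrite -(@card_in_imset _ _ f (mem A)) => [|y z yA zA /(congr1 val) /=]; last first.
  have /= := xmin _ yA; have /= := xmin _ zA => h1 h2 h3; apply/val_inj => /=; lia.
apply/subset_leq_card/fintype.subsetP => _ /imsetP[y yA ->].
rewrite inE; apply/close_multP => //=.
have [_ [c1 e1]] := geo_resP (y%:Z - j'%:Z); have [_ [c2 e2]] := geo_resP (x%:Z - j'%:Z).
exists (c1 - c2).
have xy : (x <= y)%N := xmin _ yA.
have -> : (2 * k * (y - x))%N%:Z = 2 * k%:Z * (y%:Z - j'%:Z) - 2 * k%:Z * (x%:Z - j'%:Z).
  by rewrite !PoszM -subzn //; ring.
rewrite e1 e2; move: xA yA; rewrite !inE => /eqP hx /eqP hy.
have := divn_eq (geo_res (y%:Z - j'%:Z)) L; have := divn_eq (geo_res (x%:Z - j'%:Z)) L.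
have := ltn_pmod (geo_res (y%:Z - j'%:Z)) L0; have := ltn_pmod (geo_res (x%:Z - j'%:Z)) L0.
rewrite hx hy; set r1 := geo_res (x%:Z - _); set r2 := geo_res (y%:Z - _) => h1 h2 h3 h4.
have -> : c1 * L%:Z ^+ 2 + r2%:Z - (c2 * L%:Z ^+ 2 + r1%:Z) - (c1 - c2) * L%:Z ^+ 2 = r2%:Z - r1%:Z by ring.
lia.
Qed.

Lemma sum_inv_sq n : \sum_(t < n) t.+1%:R ^- 2 <= 2 :> R.
Proof.
case: n => [|n]; first by rewrite big_ord0.
suff : \sum_(t < n.+1) t.+1%:R ^- 2 <= 2 - n.+1%:R^-1 :> R.
  by move=> /le_trans; apply; rewrite gerBl.
elim: n => [|n IH]; first by rewrite big_ord1 expr1n invr1; lra.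
rewrite big_ord_recr /=; apply: le_trans (lerD IH (lexx _)) _.
have n0 : 0 < n.+1%:R :> R by rewrite ltr0n.
have e2 : n.+2%:R = n.+1%:R + 1 :> R by rewrite -natr1.
rewrite e2; move: (n.+1%:R : R) n0 => x x0.
have h : x^-1 - (x + 1)^-1 - (x + 1) ^- 2 = x^-1 * (x + 1) ^- 2 by field; lra.
have : 0 <= x^-1 * (x + 1) ^- 2 by rewrite mulr_ge0 // invr_ge0 ?exprn_ge0; lra.
rewrite -h; lra.
Qed.

Lemma sum_geo_sq (j' : nat) :
  \sum_(j < L) normc (geo (j%:Z - j'%:Z)) ^+ 2 <=
  16 * L%:R ^+ 2 * #|close_set L k|%:R.
Proof.
pose cl (j : 'I_L) : 'I_L := Ordinal (geo_lt_cell (j%:Z - j'%:Z)).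
pose g (t : 'I_L) : R := t.+1%:R ^- 2 + (L - t)%:R ^- 2.
have g0 t : 0 <= g t by rewrite addr_ge0 // invr_ge0 exprn_ge0.
apply: (@le_trans _ _ (\sum_(j < L) 4 * L%:R ^+ 2 * g (cl j))).
  by apply: ler_sum => j _; exact: normc_geo_sq.
rewrite (partition_big cl xpredT) //=.
apply: (@le_trans _ _ (\sum_(t < L) #|close_set L k|%:R * (4 * L%:R ^+ 2 * g t))).
  apply: ler_sum => t _.
  rewrite (eq_bigr (fun=> 4 * L%:R ^+ 2 * g t)); last by move=> j /eqP ->.
  rewrite sumr_const -[leLHS]mulr_natl ler_wpM2r ?mulr_ge0 ?exprn_ge0 // ler_nat.
  apply: leq_trans (card_geo_cell j' t).
  by apply: subset_leq_card; apply/fintype.subsetP => j /eqP <-; rewrite inE.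
rewrite -mulr_sumr -mulr_sumr [leRHS]mulrC ler_wpM2l //.
have -> : 16 * L%:R ^+ 2 = 4 * L%:R ^+ 2 * 4 :> R by ring.
rewrite ler_wpM2l ?mulr_ge0 ?exprn_ge0 // big_split /=.
have -> : \sum_(t < L) (L - t)%:R ^- 2 = \sum_(t < L) t.+1%:R ^- 2 :> R.
  rewrite (reindex_inj rev_ord_inj) /=; apply: eq_bigr => t _.
  by congr (_%:R ^- 2); have := ltn_ord t; lia.
have := sum_inv_sq L; lra.
Qed.

End Weyl.

Lemma sqr_sum_le (R : realFieldType) (I : finType) (a : I -> R) :
  (\sum_i a i) ^+ 2 <= #|I|%:R * \sum_i a i ^+ 2.
Proof.
rewrite expr2 big_distrlr /=.
apply: (@le_trans _ _ (\sum_i \sum_j (a i ^+ 2 / 2 + a j ^+ 2 / 2))).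
  apply: ler_sum => i _; apply: ler_sum => j _.
  have := sqr_ge0 (a i - a j); rewrite sqrrB; lra.
have e i : \sum_j (a i ^+ 2 / 2 + a j ^+ 2 / 2) = (a i ^+ 2 / 2) *+ #|I| + \sum_j a j ^+ 2 / 2.
  by rewrite big_split /= sumr_const.
rewrite (eq_bigr _ (fun i _ => e i)) big_split /= sumr_const sumrMnl.
have -> : \sum_i a i ^+ 2 = 2 * \sum_i a i ^+ 2 / 2.
  by rewrite mulr_sumr; apply: eq_bigr => i _; field.
move: (\sum_i _) => S; rewrite -(mulr_natl S #|I|) mulrCA.
by move: (_ * S) => y; lra.
Qed.

Section WeylSum.
Context {R : realType}.
Context (L k : nat) (c : int) (L0 : (0 < L)%N).
Local Notation ee := (@exp_root R L).
Local Notation I := ('I_L * 'I_L)%type.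

(* The smoothing by two extra variables makes the differenced sum equal to the
   square of the geometric sum [geo], see [XE] in [weyl_sq_le]; squares of
   geometric sums are summable without logarithmic loss. *)
Definition weyl_sum : R[i] :=
  \sum_(p : I) \sum_(j < L) ee (k%:Z * (p.1%:Z + p.2%:Z + j%:Z - c) ^+ 2).

(** Weyl differencing: after Cauchy-Schwarz over the [L^2] pairs [p], the phases in the expanded
    square are linear in [p.1] and [p.2] with the same slope, so the sum over [p] is a unimodular
    factor times the square of [geo]. *)
Lemma weyl_sq_le :
  normc weyl_sum ^+ 2 <= 16 * L%:R ^+ 5 * #|close_set L k|%:R.
Proof.
pose z (p : I) (j : 'I_L) := ee (k%:Z * (p.1%:Z + p.2%:Z + j%:Z - c) ^+ 2).
apply: (@le_trans _ _ ((\sum_p normc (\sum_j z p j)) ^+ 2)).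
  rewrite ler_sqr ?nnegrE ?normc_ge0 ?sumr_ge0 ?normc_sum // => p _; exact: normc_ge0.
apply: le_trans (sqr_sum_le _) _.
rewrite card_prod card_ord natrM.
set X := \sum_p _.
have X0 : 0 <= X by apply: sumr_ge0 => p _; exact: exprn_ge0 (normc_ge0 _).
have XE : X%:C = \sum_(j < L) \sum_(j' < L) ee (k%:Z * (j%:Z - j'%:Z) * (j%:Z + j'%:Z - 2 * c)) *
    (geo L k (j%:Z - j'%:Z)) ^+ 2.
  have zc p j : conjc (z p j) = ee (- (k%:Z * (p.1%:Z + p.2%:Z + j%:Z - c) ^+ 2)) by exact: conj_ee.
  rewrite rmorph_sum /=.
  under eq_bigr => p _.
    rewrite sqr_normcC conjc_sum (eq_bigr _ (fun j _ => zc p j)) big_distrlr /=; over.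
  rewrite exchange_big /=; apply: eq_bigr => j _.
  rewrite exchange_big /=; apply: eq_bigr => j' _.
  rewrite expr2 [in RHS]/geo big_distrlr /= pair_bigA /= mulr_sumr; apply: eq_bigr => p _.
by rewrite /z -!eeD; congr exp_root; ring.
have XL : X <= \sum_(j' < L) \sum_(j < L) normc (@geo R L k (j%:Z - j'%:Z)) ^+ 2.
  rewrite -(normc_real X0) XE exchange_big /=.
  apply: le_trans (normc_sum _ _ _) _; apply: ler_sum => j' _.
  apply: le_trans (normc_sum _ _ _) _; apply: ler_sum => j _.
  by rewrite ComplexField.Normc.normcM normc_ee mul1r normcX.
have : X <= L%:R * (16 * L%:R ^+ 2 * #|close_set L k|%:R).
  apply: le_trans XL _.
  apply: (@le_trans _ _ (\sum_(j' < L) 16 * L%:R ^+ 2 * #|close_set L k|%:R)).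
    by apply: ler_sum => j' _; apply: sum_geo_sq.
  by rewrite sumr_const card_ord -[leLHS]mulr_natl.
move=> /(ler_wpM2l (_ : 0 <= L%:R * L%:R :> R)) => /(_ (mulr_ge0 (ler0n _ _) (ler0n _ _))).
move/le_trans; apply; rewrite le_eqVlt; apply/orP; left; apply/eqP; ring.
Qed.

End WeylSum.

Section Moments.
Context {R : realType}.

(** With [rho = 2^(1/4)], the bounds on square roots of Weyl sums and the counts of frequencies are
    all integral powers of [rho], up to constants. *)
Definition rho : R := Num.sqrt (Num.sqrt 2).

Lemma rho4 : rho ^+ 4 = 2.
Proof. by rewrite (exprM _ 2 2) !sqr_sqrtr ?sqrtr_ge0. Qed.

Lemma rho_gt1 : 1 < rho.
Proof.
have : 1 < rho ^+ 4 by rewrite rho4 ltr1n.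
have r0 : 0 <= rho := sqrtr_ge0 _.
by rewrite expr_gt1.
Qed.

Lemma rho_gt0 : 0 < rho.
Proof. exact: lt_trans ltr01 rho_gt1. Qed.

Lemma pow2_rho n : (2 ^ n)%N%:R = rho ^+ (4 * n).
Proof. by rewrite natrX exprM rho4. Qed.

Context (J : nat) (c : int).
Local Notation L := (2 ^ J)%N.

(** The square root turns moments of half-integral order, such as [9/2], into integral powers. *)
Definition root_weyl (k : nat) : R := Num.sqrt (normc (@weyl_sum R L k c)).

Lemma root_weyl_ge0 k : 0 <= root_weyl k.
Proof. exact: sqrtr_ge0. Qed.

Lemma root_weylE k : root_weyl k ^+ 2 = normc (@weyl_sum R L k c).
Proof. by rewrite sqr_sqrtr // normc_ge0. Qed.

Lemma close_set_gt0 k : (0 < #|close_set L k|)%N.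
Proof.
have L0 : (0 < L)%N by rewrite expn_gt0.
by apply/card_gt0P; exists (Ordinal L0); rewrite inE /close_mult muln0 mod0n.
Qed.

Lemma root_weyl_le k i : (#|close_set L k| < 2 ^ i.+1)%N ->
  root_weyl k <= rho ^+ (5 + 5 * J + i).
Proof.
move=> hi; have r0 := ltW rho_gt0.
rewrite -(@ler_pXn2r _ 4) ?nnegrE ?root_weyl_ge0 ?exprn_ge0 //.
rewrite (exprM _ 2 2) root_weylE.
apply: le_trans (weyl_sq_le _ _ _) _; first by rewrite expn_gt0.
apply: (@le_trans _ _ (16 * L%:R ^+ 5 * (2 ^ i.+1)%N%:R)).
  by rewrite ler_wpM2l ?mulr_ge0 ?exprn_ge0 // ler_nat ltnW.
rewrite !pow2_rho -exprM (_ : 16 = rho ^+ (4 * 4)); last by rewrite exprM rho4; ring.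
by rewrite -!exprD -exprM le_eqVlt; apply/orP; left; apply/eqP; congr (_ ^+ _); lia.
Qed.

Lemma trunc_log_close k : (2 ^ trunc_log 2 #|close_set L k| <= #|close_set L k| < 2 ^ (trunc_log 2 #|close_set L k|).+1)%N
  /\ (trunc_log 2 #|close_set L k| < J.+1)%N.
Proof.
have h0 := close_set_gt0 k.
have h1 := trunc_logP (isT : (1 < 2)%N) h0.
have h2 := trunc_log_ltn #|close_set L k| (isT : (1 < 2)%N).
split; first by rewrite h1.
rewrite ltnS -(@leq_exp2l 2) //; apply: leq_trans h1 _.
by rewrite -[X in (_ <= X)%N](card_ord L) max_card.
Qed.

Lemma root_weyl_sup k : root_weyl k <= rho ^+ (5 + 6 * J).
Proof.
have [/andP[_ h1] h2] := trunc_log_close k.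
apply: le_trans (root_weyl_le h1) _.
by rewrite ler_weXn2l ?(ltW rho_gt1) //; lia.
Qed.

(** [card_close_level] with [h = 2^(i - 2)], as [3 h < 2^i]; for [i < 2] the total number [L^2] of
    frequencies suffices. *)
Lemma card_level i : (1 < J)%N ->
  (#|[set k : 'I_(L ^ 2) | 2 ^ i <= #|close_set L k|]%N| * 4 ^ i <= 144 * L ^ 2)%N.
Proof.
move=> J1; have L2 : (2 < L)%N by rewrite (@ltn_exp2l 2 1).
have [i2|i2] := ltnP i 2.
  have ha : (#|[set k : 'I_(L ^ 2) | 2 ^ i <= #|close_set L k|]%N| <= L ^ 2)%N.
    by rewrite -[X in (_ <= X)%N](card_ord (L ^ 2)) max_card.
  have hb : (4 ^ i <= 4)%N by case: (i) i2 => [|[]].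
  by apply: leq_trans (leq_mul ha hb) _; rewrite mulnC leq_mul2r orbT.
have [j ->] : exists j, i = j.+2 by exists i.-2; lia.
have bm := card_close_level L2 (_ : 0 < 2 ^ j)%N; rewrite expn_gt0 in bm; have {}bm := bm isT.
have ab : (#|[set k : 'I_(L ^ 2) | 2 ^ j.+2 <= #|close_set L k|]%N| <=
   #|[set k : 'I_(L ^ 2) | 3 * 2 ^ j < #|close_set L k|]%N|)%N.
  apply/subset_leq_card/fintype.subsetP => k; rewrite !inE; apply: leq_trans.
  by rewrite !expnS; have := expn_gt0 2 j; lia.
have e4 : (4 ^ j = (2 ^ j) ^ 2)%N by rewrite -expnM mulnC expnM.
have -> : (4 ^ j.+2 = 16 * (2 ^ j) ^ 2)%N by rewrite (expnS 4) (expnS 4) e4 mulnA.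
apply: leq_trans (leq_mul ab (leqnn _)) _.
rewrite mulnCA [X in (_ * X <= _)%N]mulnC; apply: (@leq_trans (16 * (9 * L ^ 2))); last by rewrite mulnA.
by rewrite leq_mul2l bm orbT.
Qed.

(** Where [m_k] is about [2^i], the summand is at most [rho^(45 + 45 J + 9 i)], for at most
    [144 rho^(8 J - 8 i)] frequencies. What remains is the series of [rho^i], dominated by [i = J]:
    the total is comparable to the term of [k = 0]. *)
Lemma root_weyl_moment9 : (1 < J)%N ->
  \sum_(k < L ^ 2) root_weyl k ^+ 9 <=
  144 * rho ^+ 46 / (rho - 1) * rho ^+ (6 * J) ^+ 9.
Proof.
move=> J1; have r0 := ltW rho_gt0; have r1 := rho_gt1.
pose lev (i : nat) := [set k : 'I_(L ^ 2) | 2 ^ i <= #|close_set L k|]%N.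
apply: (@le_trans _ _ (\sum_(k < L ^ 2) \sum_(i < J.+1) (k \in lev i)%:R * rho ^+ (5 + 5 * J + i) ^+ 9)).
  apply: ler_sum => k _.
  have [/andP[h1 h2] h3] := trunc_log_close k.
  rewrite (bigD1 (Ordinal h3)) //= inE h1 mul1r.
  rewrite -[leLHS]addr0 lerD //; last first.
    by apply: sumr_ge0 => i _; rewrite mulr_ge0 // exprn_ge0 ?exprn_ge0.
  by rewrite lerXn2r ?nnegrE ?root_weyl_ge0 ?exprn_ge0 // root_weyl_le.
rewrite exchange_big /=.
apply: (@le_trans _ _ (\sum_(i < J.+1) 144 * rho ^+ (45 + 53 * J) * rho ^+ i)).
  apply: ler_sum => i _; rewrite -mulr_suml -natr_sum.
  have -> : (\sum_(k < L ^ 2) (k \in lev i) = #|lev i|)%N.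
    by rewrite -sum1_card [RHS]big_mkcond; apply: eq_bigr => k _; case: (k \in lev i).
  have := card_level i J1; rewrite -/(lev i) -(ler_nat R) natrM natrM !natrX.
  have -> : 4%:R ^+ i = rho ^+ (8 * i) :> R by rewrite (exprM _ 8) (exprM _ 4 2) rho4; congr (_ ^+ _); ring.
  have -> : 2%:R ^+ J ^+ 2 = rho ^+ (8 * J) :> R by rewrite -natrX pow2_rho -exprM; congr (_ ^+ _); lia.
  move=> /(ler_wpM2r (_ : 0 <= rho ^+ (45 + 45 * J + i))) => /(_ (exprn_ge0 _ r0)).
  have -> : rho ^+ (5 + 5 * J + i) ^+ 9 = rho ^+ (8 * i) * rho ^+ (45 + 45 * J + i).
    by rewrite -exprM -exprD; congr (_ ^+ _); lia.
  have e2 : rho ^+ (45 + 53 * J) * rho ^+ i = rho ^+ (8 * J) * rho ^+ (45 + 45 * J + i).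
    by rewrite -!exprD; congr (_ ^+ _); lia.
  by rewrite -[X in _ -> _ <= X]mulrA e2 mulrA [X in _ -> _ <= X]mulrA.
rewrite -mulr_sumr.
have -> : \sum_(i < J.+1) rho ^+ i = (rho ^+ J.+1 - 1) / (rho - 1).
  by rewrite subrX1 [_ * \sum_(i < _) _]mulrC mulfK // subr_eq0 gt_eqF.
have r1' : 0 < rho - 1 by rewrite subr_gt0.
apply: (@le_trans _ _ (144 * rho ^+ (45 + 53 * J) * (rho ^+ J.+1 / (rho - 1)))).
  apply: ler_wpM2l; first by rewrite mulr_ge0 ?exprn_ge0.
  by apply: ler_wpM2r; [rewrite invr_ge0 ltW|rewrite gerBl].
rewrite le_eqVlt; apply/orP; left; apply/eqP.
have -> : rho ^+ (45 + 53 * J) = rho ^+ 45 * rho ^+ (53 * J) by rewrite exprD.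
have -> : rho ^+ (6 * J) ^+ 9 = rho ^+ (53 * J) * rho ^+ J.
  by rewrite -exprM -exprD; congr (_ ^+ _); lia.
have -> : rho ^+ 46 = rho * rho ^+ 45 := exprS rho 45.
have -> : rho ^+ J.+1 = rho * rho ^+ J := exprS rho J.
move: (rho ^+ 45) (rho ^+ (53 * J)) (rho ^+ J) => u v w.
by field; rewrite gt_eqF.
Qed.

Lemma root_weyl_moment e : (9 <= e)%N -> (1 < J)%N ->
  \sum_(k < L ^ 2) root_weyl k ^+ e <=
  144 * rho ^+ 46 / (rho - 1) * rho ^+ (5 * (e - 9)) * rho ^+ (6 * J) ^+ e.
Proof.
move=> e9 J1; have r0 := ltW rho_gt0; have r1 := rho_gt1.
apply: (@le_trans _ _ (rho ^+ (5 + 6 * J) ^+ (e - 9) * \sum_(k < L ^ 2) root_weyl k ^+ 9)).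
  rewrite mulr_sumr; apply: ler_sum => k _.
  rewrite -{1}(subnK e9) exprD ler_wpM2r ?exprn_ge0 ?root_weyl_ge0 //.
  by rewrite lerXn2r ?nnegrE ?root_weyl_ge0 ?exprn_ge0 // root_weyl_sup.
apply: le_trans (ler_wpM2l (exprn_ge0 _ (exprn_ge0 _ r0)) (root_weyl_moment9 J1)) _.
rewrite -{3}(subnK e9) [in leRHS]exprD exprD exprMn -(exprM _ 5).
rewrite le_eqVlt; apply/orP; left; apply/eqP; ring.
Qed.

End Moments.

(** * Upper bounds for representation numbers *)

Definition rep (d N : nat) (m : int) : nat :=
  #|[set v : {ffun 'I_d -> 'I_(2 * N).+1} | ctrsq v == m]|.

Lemma ler_sum_inj (R : numDomainType) (I J : finType) (f : I -> J) (F : J -> R) :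
  injective f -> (forall j, 0 <= F j) -> \sum_i F (f i) <= \sum_j F j.
Proof.
move=> fI F0.
have -> : \sum_i F (f i) = \sum_(j in f @: [set: I]) F j.
  rewrite big_imset /=; last by move=> x y _ _; exact: fI.
  by apply: eq_bigl => i; rewrite inE.
by rewrite big_mkcond; apply: ler_sum => j _; case: ifP.
Qed.

Section Counting.
Context {R : realType}.
Context (d n : nat).
Local Notation N := (2 ^ n)%N.
Local Notation L := (2 ^ n.+3)%N.
Local Notation c := ((12 * N)%N%:Z).
Local Notation V := {ffun 'I_d -> 'I_(2 * N).+1}.
Local Notation W := {ffun 'I_d -> 'I_L * 'I_L * 'I_L}.
Local Notation ee := (@exp_root R L).
Local Notation weyl k := (@weyl_sum R L k c).

Definition tripsq (w : W) : int :=
  \sum_i ((w i).1.1%:Z + (w i).1.2%:Z + (w i).2%:Z - c) ^+ 2.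

(* Coordinatewise, every integer of [-N, N] is [a + b + j - c] for at least [N^2]
   triples [(a, b, j)]. *)
Lemma tripsq_weight (G : int -> R) : (forall m, 0 <= G m) ->
  ((N ^ 2) ^ d)%N%:R * \sum_v G (@ctrsq d N v) <= \sum_w G (tripsq w).
Proof.
move=> G0.
have N0 : (0 < N)%N by rewrite expn_gt0.
have LN : L = (8 * N)%N by rewrite !expnS; lia.
have L0 : (0 < L)%N by rewrite expn_gt0.
pose toL (x : nat) : 'I_L := Ordinal (ltn_pmod x L0).
have toLE x : (x < L)%N -> toL x = x :> nat by move=> h; rewrite /= modn_small.
(* The three entries lie in [[0, 8 N)] and add up to [v + 11 N]; subtracting [c = 12 N] leaves
   [v - N]. *)
pose f (p : V * {ffun 'I_d -> 'I_N * 'I_N}) : W :=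
  [ffun i => (toL (4 * N + (p.2 i).1)%N, toL (4 * N + (p.2 i).2)%N,
              toL (p.1 i + 3 * N - (p.2 i).1 - (p.2 i).2)%N)].
have fE p i : [/\ (f p i).1.1 = (4 * N + (p.2 i).1)%N :> nat,
    (f p i).1.2 = (4 * N + (p.2 i).2)%N :> nat &
    ((f p i).2 + (p.2 i).1 + (p.2 i).2 = p.1 i + 3 * N)%N].
  have := ltn_ord (p.2 i).1; have := ltn_ord (p.2 i).2; have := ltn_ord (p.1 i).
  by move=> h1 h2 h3; rewrite ffunE [(_, _).1]/= [(_, _).2]/=; split; rewrite toLE; lia.
have fI : injective f.
  move=> [v x] [v' x'] e; congr (_, _); apply/ffunP => i.
    have [] := fE (v, x) i; have [] := fE (v', x') i; rewrite e /= => e1 e2 e3 e4 e5 e6.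
    by apply/val_inj => /=; lia.
  have [] := fE (v, x) i; have [] := fE (v', x') i; rewrite e /= => e1 e2 e3 e4 e5 e6.
  by rewrite [x i]surjective_pairing [x' i]surjective_pairing; congr (_, _); apply/val_inj => /=; lia.
have fQ p : tripsq (f p) = ctrsq p.1.
  apply: eq_bigr => i _; congr (_ ^+ 2).
  by have [] := fE p i; lia.
apply: (le_trans _ (ler_sum_inj fI (fun w => G0 (tripsq w)))).
rewrite [leRHS](eq_bigr (fun p => G (ctrsq p.1))); last by move=> p _; rewrite fQ.
rewrite -(pair_bigA _ (fun v _ => G (ctrsq v))) /= mulr_sumr le_eqVlt; apply/orP; left; apply/eqP.
by apply: eq_bigr => v _; rewrite sumr_const card_ffun card_prod !card_ord mulnn mulr_natl.
Qed.

(** Orthogonality of characters. Summing the geometric series needs [ee a != 1], which [normc_1Bee]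
    gives from the residue of [a] or of [- a]. *)
Lemma sum_ee (a : int) : \sum_(k < L ^ 2) ee (k%:Z * a) = (L ^ 2 * (L%:Z ^+ 2 %| a)%Z)%N%:R.
Proof.
have L0 : (0 < L)%N by rewrite expn_gt0.
case: (boolP (_ %| a)%Z) => [/dvdzP[q ->]|na].
  rewrite muln1 (eq_bigr (fun=> 1)) ?sumr_const ?card_ord // => k _.
  by rewrite mulrA eeM.
rewrite muln0.
have z1 : 1 - ee a != 0.
  have M0 : L%:Z ^+ 2 != 0 by rewrite expf_neq0 // eqz_nat -lt0n.
  have LE : L%:Z ^+ 2 = (L ^ 2)%N%:Z by rewrite -!natz -natrX.
  have := modz_ge0 a M0; have := ltz_mod a M0; have := divz_eq a (L%:Z ^+ 2).
  have : (a %% L%:Z ^+ 2)%Z != 0 by apply: contra na => /eqP/dvdz_mod0P.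
  rewrite [X in `|X|]LE; move: (a %% _)%Z (a %/ _)%Z => [r|r] q // r0 aE rM _.
  have {}r0 : (0 < r)%N by rewrite lt0n -eqz_nat.
  have {}rM : (r < L ^ 2)%N by lia.
  have M0' : 0 < (L ^ 2)%N%:R :> R by rewrite ltr0n; lia.
  have nz z : 0 < normc z -> z != 0 :> R[i].
    by apply: contraTneq => ->; rewrite ComplexField.Normc.normc0 ltxx.
  have [r2|r2] := leqP (2 * r) (L ^ 2).
    rewrite (@ee_mod R L a r q) //; last by rewrite aE addrC.
    apply/nz; apply: lt_le_trans (normc_1Bee r0 r2).
    by rewrite divr_gt0 // mulr_gt0 // ltr0n.
  have h : 0 < normc (1 - ee (L ^ 2 - r)%N%:Z).
    apply: lt_le_trans (@normc_1Bee R L (L ^ 2 - r) _ _); [|lia|lia].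
    by rewrite divr_gt0 // mulr_gt0 // ltr0n; lia.
  rewrite -conjc_eq0 rmorphB rmorph1 -[X in 1 - X]/(conjc (ee a)) conj_ee.
  rewrite (@ee_mod R L (- a) (L ^ 2 - r)%N%:Z (- q - 1)) //; first exact: nz.
  by rewrite aE -subzn ?(ltnW rM) // LE; ring.
apply: (mulfI z1); rewrite mulr0.
have -> : \sum_(k < L ^ 2) ee (k%:Z * a) = \sum_(k < L ^ 2) 1 ^+ (L ^ 2 - k.+1) * ee a ^+ k.
  by apply: eq_bigr => k _; rewrite expr1n mul1r eeX mulrC.
rewrite -(prednK (_ : 0 < L ^ 2)%N) ?expn_gt0 ?L0 // -subrXX expr1n.
by rewrite prednK ?expn_gt0 ?L0 // eeX -[(L ^ 2)%N%:Z]natz natrX natz eeM // subrr.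
Qed.

(** The smoothed count of solutions modulo [L^2]; the congruence makes the set of frequencies
    finite, and [near_rep_ge] compares it with [rep]. *)
Definition near_rep (m : int) : R := \sum_(w : W) (L%:Z ^+ 2 %| tripsq w - m)%Z%:R.

Lemma sum_tripsq_ee (k : nat) : \sum_(w : W) ee (k%:Z * tripsq w) = weyl k ^+ d.
Proof.
rewrite /weyl_sum pair_bigA /= -[in RHS](card_ord d) -prodr_const.
rewrite (bigA_distr_bigA (fun (i : 'I_d) (t : 'I_L * 'I_L * 'I_L) => ee (k%:Z * (t.1.1%:Z + t.1.2%:Z + t.2%:Z - c) ^+ 2))).
by apply: eq_bigr => w _; rewrite /tripsq mulr_sumr ee_sum.
Qed.

Lemma near_repE m : (near_rep m)%:C =
  (L ^ 2)%N%:R^-1 * \sum_(k < L ^ 2) ee (- (k%:Z * m)) * weyl k ^+ d.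
Proof.
have M0 : (L ^ 2)%N%:R != 0 :> R[i] by rewrite pnatr_eq0 -lt0n !expn_gt0.
apply: (mulfI M0); rewrite mulVKf // rmorph_sum mulr_sumr /=.
under [RHS]eq_bigr do rewrite -sum_tripsq_ee mulr_sumr.
rewrite exchange_big /=; apply: eq_bigr => w _.
under eq_bigr do rewrite -eeD addrC -mulrBr.
rewrite sum_ee natrM; congr (_ * _).
by case: (_ %| _)%Z.
Qed.

Local Notation s k := (@root_weyl R n.+3 c k).

Lemma near_rep_ge m : ((N ^ 2) ^ d)%N%:R * (rep d N m)%:R <= near_rep m.
Proof.
rewrite /rep -sum1_card natr_sum big_mkcond /=.
apply: le_trans (tripsq_weight (fun q => ler0n R (L%:Z ^+ 2 %| q - m)%Z)).
rewrite ler_wpM2l //; apply: ler_sum => v _; rewrite inE.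
by case: eqP => // ->; rewrite subrr dvdz0.
Qed.

Lemma near_rep_ge0 m : 0 <= near_rep m.
Proof. by apply: sumr_ge0. Qed.

Lemma near_rep_le m : near_rep m <= (L ^ 2)%N%:R^-1 * \sum_(k < L ^ 2) s k ^+ (2 * d).
Proof.
rewrite -(normc_real (near_rep_ge0 m)) near_repE ComplexField.Normc.normcM ComplexField.Normc.normcV normc_natr.
rewrite ler_wpM2l ?invr_ge0 //; apply: le_trans (normc_sum _ _ _) _; apply: ler_sum => k _.
by rewrite ComplexField.Normc.normcM normc_ee mul1r normcX exprM root_weylE.
Qed.

Lemma weyl_periodic k : weyl (k + L ^ 2)%N = weyl k.
Proof.
apply: eq_bigr => p _; apply: eq_bigr => j _.
set q := _ ^+ 2; apply: (@ee_mod R L _ _ q); first by rewrite expn_gt0.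
by rewrite PoszD mulrDl; congr (_ + _); rewrite mulrC -!natz -natrX.
Qed.

Lemma sum_root_shift k e : \sum_(l < L ^ 2) s (k + l)%N ^+ e = \sum_(l < L ^ 2) s l ^+ e.
Proof.
elim: k => [|k IH]; first by apply: eq_bigr => l _; rewrite add0n.
rewrite -{}IH; have M0 : (0 < L ^ 2)%N by rewrite !expn_gt0.
have -> : \sum_(l < L ^ 2) s (k.+1 + l)%N ^+ e = \sum_(l < (L ^ 2).-1.+1) s (k.+1 + l)%N ^+ e.
  by rewrite prednK.
have -> : \sum_(l < L ^ 2) s (k + l)%N ^+ e = \sum_(l < (L ^ 2).-1.+1) s (k + l)%N ^+ e.
  by rewrite prednK.
rewrite big_ord_recr big_ord_recl /= addrC addn0; congr (_ + _).
  congr (_ ^+ _); rewrite /root_weyl; congr (Num.sqrt (normc _)).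
  by rewrite addSn -addnS prednK // weyl_periodic.
by apply: eq_bigr => l _; rewrite /bump /= add1n addnS addSn.
Qed.

(** Expanding the square over frequencies [k] and [l], the sum over [w] yields [weyl (k + l) ^ d].
    Once the product of three factors is symmetrized, each term involves two frequencies running
    independently over full periods. *)
Lemma near_rep_sq_le (lam : int) :
  \sum_(w : W) near_rep (lam - tripsq w) ^+ 2 <=
  ((L ^ 2)%N%:R^-1 * \sum_(k < L ^ 2) s k ^+ (3 * d)) ^+ 2.
Proof.
set X := \sum_(w : W) _.
have X0 : 0 <= X by apply: sumr_ge0 => w _; exact: sqr_ge0.
have XE : X%:C = (L ^ 2)%N%:R^-1 ^+ 2 * \sum_(k < L ^ 2) \sum_(l < L ^ 2)
   ee (- ((k + l)%N%:Z * lam)) * (weyl (k + l)%N ^+ d * weyl k ^+ d * weyl l ^+ d).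
  rewrite rmorph_sum /=.
  under eq_bigr => w _.
    rewrite expr2 rmorphM /= near_repE mulrACA big_distrlr /=; over.
  rewrite -mulr_sumr -expr2; congr (_ * _).
  rewrite exchange_big /=; apply: eq_bigr => k _.
  rewrite exchange_big /=; apply: eq_bigr => l _.
  rewrite -(sum_tripsq_ee (k + l)) !mulr_suml mulr_sumr; apply: eq_bigr => w _.
  rewrite mulrACA -eeD !mulrA -eeD; congr (ee _ * _ * _).
  by rewrite PoszD; ring.
have {XE} : X <= (L ^ 2)%N%:R^-1 ^+ 2 * \sum_(k < L ^ 2) \sum_(l < L ^ 2)
   (s (k + l)%N * s k * s l) ^+ (2 * d).
  rewrite -(normc_real X0) XE ComplexField.Normc.normcM normcX ComplexField.Normc.normcV normc_natr.
  rewrite ler_wpM2l ?exprn_ge0 ?invr_ge0 //.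
  apply: le_trans (normc_sum _ _ _) _; apply: ler_sum => k _.
  apply: le_trans (normc_sum _ _ _) _; apply: ler_sum => l _.
  by rewrite !ComplexField.Normc.normcM normc_ee mul1r !normcX !exprMn ![_ ^+ (2 * d)]exprM !root_weylE.
move=> /le_trans; apply; rewrite exprMn ler_wpM2l ?exprn_ge0 ?invr_ge0 //.
(* AM-GM: [x y z <= (x^3 + y^3 + z^3) / 3] with [x = (s_k s_l)^d], etc. *)
have amgm (x y z : R) : 0 <= x -> 0 <= y -> 0 <= z ->
    x * y * z <= (x ^+ 3 + y ^+ 3 + z ^+ 3) / 3.
  move=> x0 y0 z0.
  have : 0 <= (x + y + z) * ((x - y) ^+ 2 + (y - z) ^+ 2 + (z - x) ^+ 2).
    by rewrite mulr_ge0 ?addr_ge0 ?sqr_ge0.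
  have -> : (x + y + z) * ((x - y) ^+ 2 + (y - z) ^+ 2 + (z - x) ^+ 2) =
    2 * (x ^+ 3 + y ^+ 3 + z ^+ 3 - 3 * (x * y * z)) by ring.
  lra.
set e := (3 * d)%N.
apply: (@le_trans _ _ (\sum_(k < L ^ 2) \sum_(l < L ^ 2)
   (s (k + l)%N ^+ e * s k ^+ e + s (k + l)%N ^+ e * s l ^+ e + s k ^+ e * s l ^+ e) / 3)).
  apply: ler_sum => k _; apply: ler_sum => l _.
  have s0 := @root_weyl_ge0 R n.+3 c.
  have := amgm ((s (k + l)%N * s k) ^+ d) ((s (k + l)%N * s l) ^+ d) ((s k * s l) ^+ d).
  rewrite !exprn_ge0 ?mulr_ge0 // => /(_ isT isT isT).
  rewrite -!(exprM _ d 3) (mulnC d 3) -/e -3!exprMn.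
  have -> : s (k + l)%N * s k * (s (k + l)%N * s l) * (s k * s l) = (s (k + l)%N * s k * s l) ^+ 2 by ring.
  by rewrite -exprM !exprMn.
set S := \sum_(k < L ^ 2) s k ^+ e.
have e1 : \sum_(k < L ^ 2) \sum_(l < L ^ 2) s (k + l)%N ^+ e * s k ^+ e = S * S.
  rewrite mulr_suml; apply: eq_bigr => k _; rewrite -mulr_suml sum_root_shift mulrC; congr (_ * _).
have e2 : \sum_(k < L ^ 2) \sum_(l < L ^ 2) s (k + l)%N ^+ e * s l ^+ e = S * S.
  rewrite exchange_big /= mulr_suml; apply: eq_bigr => k _.
  by rewrite -mulr_suml; under eq_bigr do rewrite addnC; rewrite sum_root_shift mulrC.
have e3 : \sum_(k < L ^ 2) \sum_(l < L ^ 2) s k ^+ e * s l ^+ e = S * S.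
  by rewrite big_distrlr.
under eq_bigr => k _ do rewrite -mulr_suml !big_split /=.
rewrite -mulr_suml !big_split /= e1 e2 e3.
by rewrite le_eqVlt; apply/orP; left; apply/eqP; field.
Qed.

(** [near_rep_ge] serves both factors of the square and [tripsq_weight] the outer sum, whence the
    third power of the weight. *)
Lemma rep_sq_weight (lam : int) :
  ((N ^ 2) ^ d)%N%:R ^+ 3 * \sum_v (rep d N (lam - @ctrsq d N v))%:R ^+ 2 <=
  \sum_(w : W) near_rep (lam - tripsq w) ^+ 2.
Proof.
apply: (le_trans _ (tripsq_weight (fun q => sqr_ge0 (near_rep (lam - q))))).
rewrite exprS -mulrA ler_wpM2l // mulr_sumr; apply: ler_sum => v _.
by rewrite -exprMn lerXn2r ?nnegrE ?mulr_ge0 ?near_rep_ge0 // near_rep_ge.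
Qed.

End Counting.

(** Applied below with [e = 2 d] for [d >= 5] and with [e = 3 d] for [d >= 3]. *)
Lemma root_weyl_moment_pow (R : realType) (e : nat) : (9 <= e)%N ->
  exists2 C : R, 0 < C & forall n c,
    (2 ^ n.+3)%N%:R ^- 2 * \sum_(k < (2 ^ n.+3) ^ 2) @root_weyl R n.+3 c k ^+ e <=
    C * (2 ^ n)%N%:R ^- 2 * rho ^+ (6 * n) ^+ e.
Proof.
move=> e9; have r1 := @rho_gt1 R; have r0 := @rho_gt0 R.
pose C : R := 144 * rho ^+ 46 / (rho - 1) * rho ^+ (5 * (e - 9)).
have C0 : 0 < C by rewrite !mulr_gt0 ?invr_gt0 ?subr_gt0 ?exprn_gt0.
exists (C * rho ^+ 18 ^+ e); first by rewrite mulr_gt0 // !exprn_gt0.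
move=> n c.
apply: (@le_trans _ _ ((2 ^ n)%N%:R ^- 2 * (C * rho ^+ (6 * n.+3) ^+ e))).
  apply: ler_pM; rewrite ?invr_ge0 ?exprn_ge0 ?sumr_ge0 //.
  - by move=> k _; rewrite exprn_ge0 ?root_weyl_ge0.
  - rewrite lef_pV2 ?posrE ?exprn_gt0 ?ltr0n ?expn_gt0 // lerXn2r ?nnegrE // ler_nat.
    by rewrite leq_exp2l //; lia.
  - exact: root_weyl_moment.
have -> : rho ^+ (6 * n.+3) = rho ^+ 18 * rho ^+ (6 * n) :> R.
  by rewrite -exprD; congr (_ ^+ _); lia.
by rewrite exprMn le_eqVlt; apply/orP; left; apply/eqP; move: (_ ^- 2) (_ ^+ e) (_ ^+ e) => u v w; ring.
Qed.

(** The normalized moment is at most [C N^(3 d - 2)], from which the weight [N^(2 d)] of each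
    solution is divided out. *)
Lemma rep_le (R : realType) (d : nat) : (5 <= d)%N ->
  exists2 C : R, 0 < C & forall n m,
    (rep d (2 ^ n) m)%:R * (2 ^ n)%N%:R ^+ 2 <= C * (2 ^ n)%N%:R ^+ d.
Proof.
move=> d5; have [|C C0 h] := @root_weyl_moment_pow R (2 * d); first lia.
exists C => // n m; set N := (2 ^ n)%N%:R : R.
have N0 : 0 < N by rewrite ltr0n expn_gt0.
have := le_trans (@near_rep_ge R d n m) (near_rep_le d n m).
rewrite (natrX R (2 ^ n.+3) 2) => /le_trans /(_ (h n _)).
rewrite natrX natrX -/N -!exprM (_ : 6 * n * (2 * d) = 4 * n * (3 * d))%N; last by lia.
rewrite (exprM rho) -pow2_rho -/N => H.
rewrite -(ler_pM2l (_ : 0 < N ^+ (2 * d))) ?exprn_gt0 // mulrA.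
move: H; have -> : C * N ^- 2 * N ^+ (3 * d) = C * N ^+ (3 * d) / N ^+ 2 by rewrite mulrAC.
rewrite ler_pdivlMr ?exprn_gt0 // => /le_trans; apply.
by rewrite mulrCA -exprD le_eqVlt; apply/orP; left; apply/eqP; congr (_ * _ ^+ _); lia.
Qed.

(** The squared normalized moment is at most [C^2 N^(9 d - 4)], and the weight is [N^(6 d)]. *)
Lemma rep_sq_le (R : realType) (d : nat) : (3 <= d)%N ->
  exists2 C : R, 0 < C & forall n lam,
    (\sum_v (rep d (2 ^ n) (lam - @ctrsq d (2 ^ n) v))%:R ^+ 2) * (2 ^ n)%N%:R ^+ 4
      <= C * (2 ^ n)%N%:R ^+ (3 * d).
Proof.
move=> d3; have [|C C0 h] := @root_weyl_moment_pow R (3 * d); first lia.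
exists (C ^+ 2); first by rewrite exprn_gt0.
move=> n lam; set N := (2 ^ n)%N%:R : R.
have N0 : 0 < N by rewrite ltr0n expn_gt0.
have := le_trans (@rep_sq_weight R d n lam) (near_rep_sq_le d n lam).
rewrite (natrX R (2 ^ n.+3) 2); set A := _ * \sum_(k < _) _ => H.
have A0 : 0 <= A.
  rewrite mulr_ge0 ?invr_ge0 ?exprn_ge0 //; apply: sumr_ge0 => k _.
  by rewrite exprn_ge0 ?root_weyl_ge0.
have AB : A ^+ 2 <= (C * N ^- 2 * rho ^+ (6 * n) ^+ (3 * d)) ^+ 2.
  by rewrite lerXn2r ?nnegrE // ?h // (le_trans A0) ?h.
move: (le_trans H AB); move: (\sum_v _) => T {H AB A0 A}.
have eN : rho ^+ (6 * n) ^+ (3 * d) ^+ 2 = N ^+ (9 * d).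
  rewrite /N pow2_rho -!exprM; congr (_ ^+ _); lia.
rewrite [X in _ <= X -> _]exprMn eN [X in _ <= X * _ -> _]exprMn natrX natrX -/N => H.
have eL : N ^+ 2 ^+ d ^+ 3 = N ^+ (6 * d) by rewrite -!exprM; congr (_ ^+ _); lia.
rewrite eL in H; rewrite -(ler_pM2l (_ : 0 < N ^+ (6 * d))) ?exprn_gt0 // mulrA.
move: H; have -> : C ^+ 2 * N ^- 2 ^+ 2 * N ^+ (9 * d) = C ^+ 2 * N ^+ (9 * d) / N ^+ 4.
  by rewrite mulrAC -exprVn -exprM exprVn.
rewrite ler_pdivlMr ?exprn_gt0 // => /le_trans; apply.
by rewrite mulrCA -exprD le_eqVlt; apply/orP; left; apply/eqP; congr (_ * _ ^+ _); lia.
Qed.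

(** * Comparison of spherical averages with cube averages *)

Local Open Scope classical_set_scope.
Local Open Scope ring_scope.
Local Open Scope complex_scope.

Definition ctr (d N : nat) (v : {ffun 'I_d -> 'I_(2 * N).+1}) : lattice d :=
  (\row_i ((v i)%:Z - N%:Z) : 'rV[int]_d).

Lemma ctrE d N (v : {ffun 'I_d -> 'I_(2 * N).+1}) i :
  (ctr v : 'rV[int]_d) 0 i = (v i)%:Z - N%:Z.
Proof. by rewrite mxE. Qed.

Lemma ctr_inj d N : injective (@ctr d N).
Proof.
move=> v w e; apply/ffunP => i; apply/val_inj => /=.
have := ctrE v i; rewrite e ctrE; lia.
Qed.

Lemma sqnorm_ctr d N (v : {ffun 'I_d -> 'I_(2 * N).+1}) : sqnorm (ctr v) = ctrsq v.
Proof. by apply: eq_bigr => i _; rewrite ctrE. Qed.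

Lemma ctr_surj d N (u : lattice d) :
  (forall i, `|(u : 'rV[int]_d) 0 i| <= N%:Z) -> exists v, u = @ctr d N v.
Proof.
move=> h; exists [ffun i => inord (absz ((u : 'rV[int]_d) 0 i + N%:Z)%R)].
by apply/rowP => i; rewrite !mxE ffunE inordK; have := h i; lia.
Qed.

Lemma sqnorm_ge0 d (u : lattice d) : 0 <= sqnorm u.
Proof. by apply: sumr_ge0 => i _; exact: sqr_ge0. Qed.

Lemma coord_le_sqnorm d (u : lattice d) i (N : nat) :
  sqnorm u <= (N ^ 2)%N%:Z -> `|(u : 'rV[int]_d) 0 i| <= N%:Z.
Proof.
move=> h; rewrite -ler_sqr ?nnegrE // real_normK ?num_real //.
rewrite -[N%:Z]natz -natrX natz; apply: le_trans h.
by rewrite /sqnorm (bigD1 i) //= lerDl; apply: sumr_ge0 => j _; exact: sqr_ge0.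
Qed.

Lemma lattice_sphereE (d N l : nat) : (l <= N ^ 2)%N ->
  lattice_sphere d l = [set` [seq (ctr p.1, ctr p.2) | p <- enum
    [pred p : {ffun 'I_d -> 'I_(2 * N).+1} * {ffun 'I_d -> 'I_(2 * N).+1} |
     ctrsq p.1 + ctrsq p.2 == l%:Z]]].
Proof.
move=> lN; apply/seteqP; split => [[u v] /= e|w /= /mapP[p]].
  have lN' : l%:Z <= (N ^ 2)%N%:Z by rewrite lez_nat.
  have [|x ux] := @ctr_surj d N u.
    by move=> i; apply: coord_le_sqnorm; apply: le_trans lN'; rewrite -e lerDl sqnorm_ge0.
  have [|y vy] := @ctr_surj d N v.
    by move=> i; apply: coord_le_sqnorm; apply: le_trans lN'; rewrite -e lerDr sqnorm_ge0.
  apply/mapP; exists (x, y); last by rewrite ux vy.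
  by rewrite mem_enum inE /= -!sqnorm_ctr -ux -vy e.
by rewrite mem_enum inE => /eqP e ->; rewrite /lattice_sphere /= !sqnorm_ctr.
Qed.

Lemma big_sphere (T : Type) (idx : T) (op : Monoid.com_law idx) (d N l : nat)
    (F : lattice d * lattice d -> T) : (l <= N ^ 2)%N ->
  \big[op/idx]_(w \in lattice_sphere d l) F w =
  \big[op/idx]_(p : {ffun 'I_d -> 'I_(2 * N).+1} * {ffun 'I_d -> 'I_(2 * N).+1} |
     ctrsq p.1 + ctrsq p.2 == l%:Z) F (ctr p.1, ctr p.2).
Proof.
move=> lN; rewrite (lattice_sphereE d lN) -fsbig_seq ?big_map ?big_enum //.
by rewrite map_inj_uniq ?enum_uniq // => [[a b] [a' b'] [/ctr_inj -> /ctr_inj ->]].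
Qed.

Lemma sphere_cardE (d N l : nat) : (l <= N ^ 2)%N -> sphere_card d l = pair_rep d N l%:Z.
Proof.
move=> lN; rewrite /sphere_card card_fset_sum1 -fsbig_finite.
  rewrite (big_sphere _ _ lN) /pair_rep -sum1_card.
  by apply: eq_bigl => p; rewrite inE.
by rewrite (lattice_sphereE d lN); exact: finite_seq.
Qed.

Lemma avg_bound (R : realType) (d N l : nat) (f g : lattice d -> R[i]) (G : R) x :
  (l <= N ^ 2)%N -> (forall y, normc (g y) <= G) ->
  normc (spherical_avg f g l x) <=
  G * ((pair_rep d N l%:Z)%:R^-1 *
    \sum_(u : {ffun 'I_d -> 'I_(2 * N).+1}) (rep d N (l%:Z - ctrsq u))%:R * normc (f (x - ctr u))).
Proof.
move=> lN gG; rewrite /spherical_avg (sphere_cardE d lN) ComplexField.Normc.normcM ComplexField.Normc.normcV normc_natr.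
rewrite mulrCA ler_wpM2l ?invr_ge0 //.
rewrite (big_sphere _ _ lN).
apply: le_trans (normc_sum _ _ _) _.
under eq_bigr do rewrite ComplexField.Normc.normcM /=.
apply: (@le_trans _ _ (\sum_(p : {ffun 'I_d -> 'I_(2 * N).+1} * {ffun 'I_d -> 'I_(2 * N).+1} |
     ctrsq p.1 + ctrsq p.2 == l%:Z) normc (f (x - ctr p.1)) * G)).
  by apply: ler_sum => p _; rewrite ler_wpM2l ?normc_ge0.
rewrite -mulr_suml mulrC le_eqVlt; apply/orP; left; apply/eqP; congr (_ * _).
rewrite big_mkcond -(pair_bigA _ (fun u v => if ctrsq u + ctrsq v == l%:Z then normc (f (x - ctr u)) else 0)) /=.
apply: eq_bigr => u _; rewrite -big_mkcond /= sumr_const -[LHS]mulr_natl; congr (_%:R * _).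
by rewrite /rep; apply: eq_card => v; rewrite !inE [in RHS]eq_sym subr_eq addrC eq_sym.
Qed.

(** The normalization [2^(n d)], comparable to the number of points of the cube, matches
    [maximal_box]. *)
Definition cube_avg (R : realType) (d n : nat) (h : lattice d -> R) (x : lattice d) : R :=
  ((2 ^ n) ^ d)%N%:R^-1 * \sum_(u : {ffun 'I_d -> 'I_(2 * 2 ^ n).+1}) h (x - ctr u).

Lemma cauchy_schwarz_sum (R : realFieldType) (I : finType) (a b : I -> R) :
  (\sum_i a i * b i) ^+ 2 <= (\sum_i a i ^+ 2) * (\sum_i b i ^+ 2).
Proof.
rewrite expr2 !big_distrlr /=.
have -> : \sum_i \sum_j a i ^+ 2 * b j ^+ 2 =
    \sum_i \sum_j (a i ^+ 2 * b j ^+ 2 / 2) + \sum_i \sum_j (a j ^+ 2 * b i ^+ 2 / 2).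
  rewrite [X in _ + X]exchange_big /= -big_split; apply: eq_bigr => i _ /=.
  by rewrite -big_split; apply: eq_bigr => j _ /=; field.
rewrite -big_split; apply: ler_sum => i _ /=; rewrite -big_split; apply: ler_sum => j _ /=.
have := sqr_ge0 (a i * b j - a j * b i); rewrite sqrrB !exprMn.
have -> : a i * b i * (a j * b j) = a i * b j * (a j * b i) by ring.
by rewrite -mulr_natl; lra.
Qed.

(** For [d >= 5] each weight is at most a constant times [N^(d-2) / N^(2d-2) = N^(-d)]. For
    [d = 3, 4], Cauchy-Schwarz uses the square mean instead: [N^(3d-4) / N^(4d-4) = N^(-d)]. *)
Lemma avg_le_cube_avg (R : realType) (d : nat) : (3 <= d)%N ->
  exists2 K : R, 0 < K & forall (f g : lattice d -> R[i]) (G : R) l x,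
    (forall y, normc (g y) <= G) -> (0 < l)%N ->
    exists n, normc (spherical_avg f g l x) ^+ (if (5 <= d)%N then 1 else 2)
      <= K * G ^+ (if (5 <= d)%N then 1 else 2) *
         cube_avg n (fun y => normc (f y) ^+ (if (5 <= d)%N then 1 else 2)) x.
Proof.
move=> d3; have [c c0 Pge] := pair_rep_ge d3.
have scale l : (0 < l)%N -> exists n, (l <= (2 ^ n) ^ 2)%N && ((2 ^ n) ^ 2 < 4 * l)%N.
  move=> l0; have ex : exists n, (l <= (2 ^ n) ^ 2)%N.
    exists l; apply: leq_trans (ltnW (ltn_expl l (isT : (1 < 2)%N))) _.
    by rewrite -mulnn leq_pmulr // expn_gt0.
  (* The second inequality is the minimality of [n]. *)
  exists (ex_minn ex); case: ex_minnP => n -> nmin /=.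
  case: n nmin => [|n] nmin; first by rewrite exp1n; lia.
  by have := nmin n; rewrite ltnn (expnS 2 n) expnMn; case: leqP => //; lia.
have Pinv n l : (0 < l)%N -> (l <= (2 ^ n) ^ 2)%N -> ((2 ^ n) ^ 2 < 4 * l)%N ->
    (pair_rep d (2 ^ n) l%:Z)%:R^-1 <= c%:R / (2 ^ n)%N%:R ^+ (2 * d - 2) :> R.
  move=> l0 lN Nl; have := Pge n l l0 lN Nl; rewrite -(ler_nat R) natrM natrX => h.
  have N0 : 0 < (2 ^ n)%N%:R ^+ (2 * d - 2) :> R by rewrite exprn_gt0 // ltr0n expn_gt0.
  have P0 : 0 < (pair_rep d (2 ^ n) l%:Z)%:R :> R.
    rewrite lt_def ler0n andbT; apply: contraTneq h => ->.
    by rewrite mulr0 -ltNge.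
  by rewrite ler_pdivlMr // ler_pdivrMl // mulrC.
have bound_ge0 (g : lattice d -> R[i]) G : (forall y, normc (g y) <= G) -> 0 <= G.
  by move=> h; apply: le_trans (h 0); exact: normc_ge0.
have powE (N : R) : 0 < N -> N ^+ (2 * d - 2) = N ^+ d * N ^+ d / N ^+ 2.
  move=> N0; apply: (canRL (mulfK _)); first by rewrite expf_neq0 ?gt_eqF.
  by rewrite -!exprD; congr (_ ^+ _); lia.
case: (leqP 5 d) => d5.
  have [C C0 repC] := rep_le R d5.
  exists (c%:R * C); first by rewrite mulr_gt0 // ltr0n.
  move=> f g G l x gG l0; have [n /andP[lN Nl]] := scale l l0; exists n.
  rewrite !expr1; apply: le_trans (avg_bound f x lN gG) _.
  rewrite mulrAC [leRHS]mulrC ler_wpM2l ?(bound_ge0 _ _ gG) //.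
  rewrite /cube_avg natrX; set N := (2 ^ n)%N%:R : R.
  have N0 : 0 < N by rewrite ltr0n expn_gt0.
  apply: (@le_trans _ _ (c%:R / N ^+ (2 * d - 2) * \sum_(u : {ffun 'I_d -> 'I_(2 * 2 ^ n).+1})
     C * N ^+ d / N ^+ 2 * normc (f (x - ctr u)))).
    apply: ler_pM; rewrite ?invr_ge0 //.
    - by apply: sumr_ge0 => u _; rewrite mulr_ge0 ?normc_ge0.
    - exact: Pinv.
    apply: ler_sum => u _; rewrite ler_wpM2r ?normc_ge0 //.
    by rewrite ler_pdivlMr ?exprn_gt0 //; exact: repC.
  rewrite -mulr_sumr; set S := \sum_(u : {ffun 'I_d -> 'I_(2 * 2 ^ n).+1}) _.
  rewrite !mulrA ler_wpM2r //; first by apply: sumr_ge0 => u _; exact: normc_ge0.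
  rewrite le_eqVlt; apply/orP; left; apply/eqP.
  rewrite powE //; have : N ^+ d != 0 by rewrite expf_neq0 ?gt_eqF.
  by move: (N ^+ d) => w w0; field; rewrite w0 gt_eqF.
have [C C0 repC] := rep_sq_le R d3.
exists (c%:R ^+ 2 * C); first by rewrite mulr_gt0 // exprn_gt0 // ltr0n.
move=> f g G l x gG l0; have [n /andP[lN Nl]] := scale l l0; exists n.
have G0 := bound_ge0 _ _ gG.
rewrite /cube_avg natrX; set N := (2 ^ n)%N%:R : R.
have N0 : 0 < N by rewrite ltr0n expn_gt0.
set S := \sum_(u : {ffun 'I_d -> 'I_(2 * 2 ^ n).+1}) _.
have S0 : 0 <= S by apply: sumr_ge0 => u _; rewrite exprn_ge0 ?normc_ge0.
have h1 := avg_bound f x lN gG.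
have h2 : normc (spherical_avg f g l x) ^+ 2 <= (G * ((pair_rep d (2 ^ n) l%:Z)%:R^-1 *
    \sum_(u : {ffun 'I_d -> 'I_(2 * 2 ^ n).+1}) (rep d (2 ^ n) (l%:Z - ctrsq u))%:R * normc (f (x - ctr u)))) ^+ 2.
  by rewrite lerXn2r ?nnegrE ?normc_ge0 // (le_trans _ h1) ?normc_ge0.
apply: le_trans h2 _; rewrite exprMn [leRHS]mulrAC [leRHS]mulrC ler_wpM2l ?exprn_ge0 //.
rewrite exprMn.
apply: (@le_trans _ _ ((c%:R / N ^+ (2 * d - 2)) ^+ 2 * (C * N ^+ (3 * d) / N ^+ 4 * S))).
  apply: ler_pM; rewrite ?sqr_ge0 //.
    by rewrite lerXn2r ?nnegrE ?invr_ge0 ?divr_ge0 ?exprn_ge0 // Pinv.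
  apply: le_trans (cauchy_schwarz_sum _ _) _; rewrite ler_wpM2r //.
  by rewrite ler_pdivlMr ?exprn_gt0 //; exact: repC.
rewrite !mulrA ler_wpM2r // le_eqVlt; apply/orP; left; apply/eqP.
rewrite powE // (mulnC 3) exprM; have : N ^+ d != 0 by rewrite expf_neq0 ?gt_eqF.
by move: (N ^+ d) => w w0; field; rewrite w0 gt_eqF.
Qed.

(** * The Hardy-Littlewood inequality on cubes of the lattice *)

Lemma hardy_littlewood (R : realType) (d : nat) (P : R) : 1 < P ->
  exists2 C : R, 0 < C & forall (h : lattice d -> R) (X J : nat), (forall x, 0 <= h x) ->
    \sum_(v : {ffun 'I_d -> 'I_(2 * (X + 2 ^ J)).+1} |
        [forall i, `|(ctr v : 'rV[int]_d) 0 i| <= X%:Z])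
      (\big[Num.max/0]_(n < J) cube_avg n h (ctr v)) `^ P <=
    C * \sum_(v : {ffun 'I_d -> 'I_(2 * (X + 2 ^ J)).+1}) h (ctr v) `^ P.
Proof.
move=> P1; exists ((8 ^ d * 2 ^ d)%N%:R `^ P * 2 ^+ d * (2 `^ (P + 1) / (P - 1))).
  by rewrite !mulr_gt0 ?powR_gt0 ?exprn_gt0 ?invr_gt0 ?subr_gt0 // ?ltr0n ?muln_gt0 ?expn_gt0.
(* The cube of radius [H] contains [x - u] for all [x] in the cube of radius [X] and [u] in that of
   radius [2^n], [n < J]. *)
move=> h X J h0; set H := (X + 2 ^ J)%N.
pose F (v : {ffun 'I_d -> 'I_(2 * H).+1}) := h (ctr v).
have F0 v : 0 <= F v by exact: h0.
apply: le_trans (maximal_box F0 P1 (leqnn (J + 2))).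
rewrite big_mkcond; apply: ler_sum => v _; case: ifP => [/forallP vX|_]; last exact: powR_ge0.
have avg0 n x : 0 <= cube_avg n h x.
  by rewrite mulr_ge0 ?invr_ge0 //; apply: sumr_ge0 => u _.
have max0 (I : finType) (f : I -> R) : (forall i, 0 <= f i) -> 0 <= \big[Num.max/0]_i f i.
  by move=> f0; apply: (big_ind (fun a : R => 0 <= a)) => // a b ha hb; rewrite le_max ha.
apply: ge0_ler_powR; rewrite ?nnegrE ?max0 //; first lra.
  by move=> n; rewrite mulr_ge0 ?invr_ge0 ?sumr_ge0.
apply: (big_ind2 (fun a b : R => a <= b)) => // [a b a' b' ab ab'|n _].
  by rewrite ge_max !le_max ab ab' orbT.
rewrite /cube_avg ler_wpM2l ?invr_ge0 //; set r := (2 ^ n)%N.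
have rJ : (r <= 2 ^ J)%N by rewrite leq_exp2l // ltnW.
have XH : (X + r <= H)%N by rewrite leq_add2l.
pose phi (u : {ffun 'I_d -> 'I_(2 * r).+1}) : {ffun 'I_d -> 'I_(2 * H).+1} :=
  [ffun i => inord (v i + r - u i)].
have vb i : (H <= v i + X)%N /\ (v i <= H + X)%N.
  have := vX i; rewrite ctrE; move: (nat_of_ord (v i)) => a h'.
  split; lia.
have rv i : (r <= v i)%N.
  by have [h1 _] := vb i; rewrite -(leq_add2l X) (leq_trans XH) // addnC.
have ur (u : {ffun 'I_d -> 'I_(2 * r).+1}) i : (u i <= 2 * r)%N by rewrite -ltnS ltn_ord.
have phiE u i : phi u i = (v i + r - u i)%N :> nat.
  by rewrite ffunE inordK //; have [? ?] := vb i; have := ltn_ord (u i); lia.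
have phiI : injective phi.
  move=> u w /ffunP e; apply/ffunP => i; apply/val_inj => /=.
  have := phiE u i; rewrite e phiE; have := ltn_ord (u i); have := ltn_ord (w i); have [? ?] := vb i; lia.
have ctrphi u : ctr v - ctr u = ctr (phi u).
  have key (a b m k : nat) : (b <= a + k)%N ->
    a%:Z - m%:Z - (b%:Z - k%:Z) = (a + k - b)%N%:Z - m%:Z by lia.
  apply/rowP => i; rewrite !mxE phiE; apply: key.
  by apply: (leq_trans (ur u i)); rewrite mul2n -addnn leq_add2r.
rewrite [leRHS]big_mkcond /=.
have G0 y : 0 <= (if y \in near_box r v then F y else 0) by case: ifP.
apply: le_trans (ler_sum_inj phiI G0).
apply: ler_sum => u _; rewrite ctrphi ifT //.
have key (a b k : nat) : (b <= 2 * k)%N -> (k <= a)%N ->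
  ((a <= a + k - b + k) && (a + k - b <= a + k))%N by lia.
by apply/forallP => i; rewrite phiE; exact: key.
Qed.

(** * Counting measure, norms, and passage to the whole lattice *)

Local Open Scope ereal_scope.

Lemma integral_box (R : realType) (d H : nat) (f : lattice d -> \bar R) :
  (forall x, 0 <= f x) ->
  \int[@counting (lattice d) R]_(x in [set` codom (@ctr d H)]) f x =
  \sum_(v : {ffun 'I_d -> 'I_(2 * H).+1}) f (ctr v).
Proof.
move=> f0.
have -> : [set` codom (@ctr d H)] =
    \big[setU/set0]_(v : {ffun 'I_d -> 'I_(2 * H).+1}) [set ctr v].
  apply/seteqP; split => [x /= /codomP[v ->]|x].
    by rewrite -bigcup_seq; exists v => //=; rewrite mem_index_enum.
  by rewrite -bigcup_seq => [[v _ /= ->]]; exact: codom_f.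
rewrite ge0_integral_bigsetU ?index_enum_uniq //.
- apply: eq_bigr => v _.
  rewrite (eq_integral (cst (f (ctr v)))); last by move=> x; rewrite inE => ->.
  rewrite integral_cst // [X in _ * X](_ : _ = 1) ?mule1 //.
  by rewrite -[LHS]/(@counting (lattice d) R [set ctr v]) /counting asboolT // fset_set1 cardfs1.
- move=> v w _ _ [x [/= -> /ctr_inj]].
  by [].
Qed.


Lemma counting_set1 (R : realType) d (x : lattice d) : @counting (lattice d) R [set x] = 1.
Proof. by rewrite /counting asboolT // fset_set1 cardfs1. Qed.

Lemma counting_ae (R : realType) d (Q : lattice d -> Prop) :
  (\forall x \ae @counting (lattice d) R, Q x) -> forall x, Q x.
Proof.
move=> [N [mN N0 QN]] x; apply: contrapT => nQ.
have : @counting (lattice d) R [set x] <= @counting (lattice d) R N.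
  by apply: le_measure; rewrite ?inE // => _ ->; exact: QN.
by rewrite N0 counting_set1 lee_fin ler10.
Qed.

Lemma counting_setT_gt0 (R : realType) d : 0 < @counting (lattice d) R [set: lattice d].
Proof.
apply: (@lt_le_trans _ _ (@counting (lattice d) R [set 0%R])).
  by rewrite counting_set1 lte_fin ltr01.
by apply: le_measure; rewrite ?inE.
Qed.

Lemma clp_norm_oo_ge (R : realType) d (g : lattice d -> R[i]) y :
  (normc (g y))%:E <= clp_norm +oo g.
Proof.
rewrite /clp_norm /lp_norm unlock counting_setT_gt0.
have := ess_sup_ge (@counting (lattice d) R) (abse \o (fun x => (normc (g x))%:E)).
by move=> /counting_ae /(_ y) /=; rewrite ger0_norm ?normc_ge0.
Qed.

Lemma clp_norm_oo_bound (R : realType) d (g : lattice d -> R[i]) y :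
  clp_norm +oo g < +oo -> (normc (g y) <= fine (clp_norm +oo g))%R.
Proof.
move=> goo; rewrite -lee_fin fineK ?clp_norm_oo_ge //.
by rewrite ge0_fin_numE // Lnorm_ge0.
Qed.

Lemma spherical_max_ge0 (R : realType) d (f g : lattice d -> R[i]) x : 0 <= spherical_max f g x.
Proof.
apply: le_trans (ereal_sup_ubound (_ : [set _ | _ in _] (normc (spherical_avg f g 1 x))%:E)).
  by rewrite lee_fin normc_ge0.
by exists 1%N.
Qed.

Lemma spherical_avg_le (R : realType) d (f g : lattice d -> R[i]) (F G : R) l x :
  (forall y, (normc (f y) <= F)%R) -> (forall y, (normc (g y) <= G)%R) ->
  (normc (spherical_avg f g l x) <= F * G)%R.
Proof.
move=> fF gG.
have F0 : (0 <= F)%R by apply: le_trans (fF 0%R); exact: normc_ge0.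
have G0 : (0 <= G)%R by apply: le_trans (gG 0%R); exact: normc_ge0.
have lN : (l <= l ^ 2)%N by case: l => // l; rewrite -mulnn leq_pmulr.
rewrite /spherical_avg (sphere_cardE d lN) ComplexField.Normc.normcM ComplexField.Normc.normcV normc_natr.
rewrite (big_sphere _ _ lN).
have -> : pair_rep d l l%:Z = #|[pred p : {ffun 'I_d -> 'I_(2 * l).+1} * {ffun 'I_d -> 'I_(2 * l).+1} |
     (ctrsq p.1 + ctrsq p.2)%R == l%:Z]|.
  by apply: eq_card => p; rewrite !inE.
set A := [pred p | _].
(* On an empty sphere the inverse of the cardinality is 0 by convention, and so is the average. *)
have [->|A0] := posnP #|A|; first by rewrite invr0 mul0r mulr_ge0.
rewrite ler_pdivrMl ?ltr0n //; apply: le_trans (normc_sum _ _ _) _.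
rewrite mulr_natl -sumr_const; apply: ler_sum => p _.
by rewrite ComplexField.Normc.normcM ler_pM ?normc_ge0.
Qed.

Lemma spherical_max_oo (R : realType) d (f g : lattice d -> R[i]) :
  clp_norm +oo f < +oo -> clp_norm +oo g < +oo ->
  lp_norm +oo (spherical_max f g) <= clp_norm +oo f * clp_norm +oo g.
Proof.
move=> foo goo; rewrite {1}/lp_norm unlock counting_setT_gt0.
have fin (h : lattice d -> R[i]) : clp_norm +oo h < +oo -> clp_norm +oo h = (fine (clp_norm +oo h))%:E.
  by move=> hoo; rewrite fineK // ge0_fin_numE // Lnorm_ge0.
rewrite (fin f foo) (fin g goo) -EFinM; apply/ess_supP; apply: nearW => x /=.
rewrite gee0_abs ?spherical_max_ge0 //; apply: ge_ereal_sup => _ [l _ <-].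
by rewrite lee_fin; apply: spherical_avg_le => y; exact: clp_norm_oo_bound.
Qed.

(** [M] is the [P]-th power of the maximal function, obtained as an increasing limit of extended
    reals, so that monotone convergence carries the inequality on cubes over to the lattice. *)
Lemma hardy_littlewood_integral (R : realType) (d : nat) (P : R) : (1 < P)%R ->
  exists2 C : R, (0 < C)%R & forall (h : lattice d -> R), (forall x, (0 <= h x)%R) ->
    exists M : lattice d -> \bar R, [/\ forall x, 0 <= M x,
     forall n x, (cube_avg n h x `^ P)%:E <= M x &
     \int[@counting (lattice d) R]_x M x <=
       C%:E * \int[@counting (lattice d) R]_x (h x `^ P)%:E].
Proof.
move=> P1; have [C C0 HL] := hardy_littlewood d P1; exists C => // h h0.
have avg0 n x : (0 <= cube_avg n h x)%R.
  by rewrite mulr_ge0 ?invr_ge0 //; apply: sumr_ge0 => u _.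
pose mx J x : R := (\big[Num.max/0]_(n < J) cube_avg n h x)%R.
have mx0 J x : (0 <= mx J x)%R.
  by apply: (big_ind (fun a : R => 0 <= a)%R) => // a b ha hb; rewrite le_max ha.
have mxS (J J' : nat) x : (J <= J')%N -> (mx J x <= mx J' x)%R.
  move=> JJ'; apply: (big_ind (fun a : R => a <= mx J' x)%R) => // [a b ha hb|n _].
    by rewrite ge_max ha.
  by rewrite /mx (bigD1 (widen_ord JJ' n)) //= le_max lexx.
(* Scales and points are truncated together, so [hJ] increases with [J] and is supported in a
   cube. *)
pose hJ (J : nat) (x : lattice d) : \bar R :=
  if [forall i, `|(x : 'rV[int]_d) 0 i| <= J%:Z]%R then (mx J x `^ P)%:E else 0.
have hJ0 J x : 0 <= hJ J x by rewrite /hJ; case: ifP => _ //; rewrite lee_fin powR_ge0.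
have hJS x : nondecreasing_seq (hJ ^~ x).
  move=> J J' JJ'; rewrite /hJ; case: ifP => [/forallP xJ|_]; last first.
    by case: ifP => _ //; rewrite lee_fin powR_ge0.
  rewrite ifT; last by apply/forallP => i; rewrite (le_trans (xJ i)) // lez_nat.
  by rewrite lee_fin ge0_ler_powR ?nnegrE //; [lra|exact: mxS].
have intJ J : \int[@counting (lattice d) R]_x hJ J x <=
    C%:E * \int[@counting (lattice d) R]_x (h x `^ P)%:E.
  pose H := (J + 2 ^ J)%N.
  have -> : \int[@counting (lattice d) R]_x hJ J x =
      \int[@counting (lattice d) R]_(x in [set` codom (@ctr d H)]) hJ J x.
    rewrite [RHS]integral_mkcond; apply: eq_integral => x _; rewrite /patch.
    case: ifPn => // xH; rewrite /hJ; case: ifP => // /forallP xJ.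
    have [i|v xv] := @ctr_surj d H x.
      by apply: le_trans (xJ i) _; rewrite lez_nat leq_addr.
    by move: xH; rewrite xv notin_setE /= codom_f.
  rewrite integral_box //.
  apply: (@le_trans _ _ (C%:E * \int[@counting (lattice d) R]_(x in [set` codom (@ctr d H)]) (h x `^ P)%:E)).
    rewrite integral_box => [|x]; last by rewrite lee_fin powR_ge0.
    rewrite sumEFin -EFinM.
    rewrite (eq_bigr (fun v => (if [forall i, `|(ctr v : 'rV[int]_d) 0 i| <= J%:Z]%R then mx J (ctr v) `^ P else 0%R)%:E)); last first.
      by move=> v _; rewrite /hJ; case: ifP.
    by rewrite sumEFin lee_fin -big_mkcond; exact: HL.
  apply: lee_wpmul2l; first by rewrite lee_fin ltW.
  by apply: ge0_subset_integral => // x _; rewrite lee_fin powR_ge0.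
exists (fun x => limn (hJ ^~ x)); split.
- by move=> x; apply: lime_ge; [exact: ereal_nondecreasing_is_cvgn|exact: nearW].
- move=> n x; rewrite (cvg_lim _ (ereal_nondecreasing_cvgn (hJS x))) //.
  (* Large enough to admit both the point [x] and the scale [n]. *)
  pose J := (n.+1 + \sum_i absz ((x : 'rV[int]_d) 0%R i))%N.
  have xJ : [forall i, `|(x : 'rV[int]_d) 0 i| <= J%:Z]%R.
    apply/forallP => i; rewrite -abszE lez_nat /J (bigD1 i) //=; lia.
  apply: le_trans (ereal_sup_ubound (_ : range (hJ ^~ x) (hJ J x))); last by exists J.
  rewrite /hJ xJ lee_fin ge0_ler_powR ?nnegrE //; first lra.
  have nJ : (n < J)%N by rewrite /J addSn ltnS leq_addr.
  by rewrite /mx (bigD1 (Ordinal nJ)) //= le_max lexx.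
- rewrite monotone_convergence //.
  apply: lime_le; last by apply: nearW => J; apply: intJ.
  apply: ereal_nondecreasing_is_cvgn => J J' JJ'.
  by apply: ge0_le_integral => // x _; exact: hJS.
Qed.

(** * The estimate for finite exponents and the theorem *)

Lemma le_poweR (R : realType) (x y : \bar R) (r : R) :
  (0 <= r)%R -> 0 <= x -> x <= y -> x `^ r <= y `^ r.
Proof.
move=> r0 x0 xy; apply: gt0_ler_poweR => //; rewrite in_itv /= leey andbT //.
exact: le_trans xy.
Qed.

Lemma spherical_max_fin (R : realType) (d : nat) (p : R) : (3 <= d)%N ->
  (d%:R / (d%:R - 2) < p)%R ->
  exists C : R, forall f g : lattice d -> R[i],
    clp_norm p%:E f < +oo -> clp_norm +oo g < +oo ->
    lp_norm p%:E (spherical_max f g) <= C%:E * clp_norm p%:E f * clp_norm +oo g.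
Proof.
move=> d3 pd; pose s := (if (5 <= d)%N then 1 else 2)%N.
have s0 : (0 < s%:R :> R)%R by rewrite /s; case: ifP.
have p1 : (1 < p)%R.
  apply: lt_trans pd; have d2 : (0 < d%:R - 2 :> R)%R by rewrite subr_gt0 ltr_nat.
  by rewrite ltr_pdivlMr // mul1r; lra.
(* Either [s = 1], or [d <= 4] and [d / (d - 2) >= 2 = s]. *)
have P1 : (1 < p / s%:R)%R.
  rewrite ltr_pdivlMr // mul1r; rewrite /s; case: leqP => // d5; apply: le_lt_trans pd.
  have d2 : (0 < d%:R - 2 :> R)%R by rewrite subr_gt0 ltr_nat.
  have d4 : (d%:R <= 4 :> R)%R by rewrite ler_nat.
  by rewrite ler_pdivlMr //; lra.
have [K K0 HK] := @avg_le_cube_avg R d d3.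
have [C C0 HC] := @hardy_littlewood_integral R d _ P1.
set P := (p / s%:R)%R in P1 HC.
have sP : (s%:R * P = p)%R by rewrite /P mulrCA divff ?mulr1 // gt_eqF.
exists ((K `^ P * C) `^ p^-1)%R => f g foo goo.
have p0 : (0 < p)%R := lt_trans ltr01 p1.
have P0 : (0 <= P)%R := ltW (lt_trans ltr01 P1).
set G := fine (clp_norm +oo g).
have gG y : (normc (g y) <= G)%R by exact: clp_norm_oo_bound.
have G0 : (0 <= G)%R := le_trans (normc_ge0 _) (gG 0%R).
have GE : clp_norm +oo g = G%:E by rewrite /G fineK // ge0_fin_numE // Lnorm_ge0.
have powE (x : R) : (0 <= x)%R -> ((x ^+ s) `^ P = x `^ p)%R.
  by move=> x0; rewrite -powR_mulrn // -powRrM sP.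
have h0 y : (0 <= normc (f y) ^+ s)%R by rewrite exprn_ge0 ?normc_ge0.
have [M [M0 MP MI]] := HC _ h0.
(* As [s P = p], this is [K^P G^p], whose [p]-th root gives [G] to the first power. *)
pose c := ((K * G ^+ s) `^ P)%R.
have cE : c = (K `^ P * G `^ p)%R by rewrite /c powRM ?exprn_ge0 ?(ltW K0) // powE.
have c0 : (0 <= c)%R by exact: powR_ge0.
have sphM x : `|spherical_max f g x| `^ p <= c%:E * M x.
  have z0 : 0 <= c%:E * M x by rewrite mule_ge0.
  rewrite gee0_abs ?spherical_max_ge0 //.
  (* The power [p] is moved to the right side so that the supremum can be bounded member by
     member. *)
  have -> : c%:E * M x = (c%:E * M x) `^ p^-1 `^ p.
    by rewrite -poweRrM mulVf ?gt_eqF // poweRe1.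
  apply: le_poweR; [exact: ltW|exact: spherical_max_ge0|].
  apply: ge_ereal_sup => _ [l /= l0 <-].
  have -> : (normc (spherical_avg f g l x))%:E = (normc (spherical_avg f g l x))%:E `^ p `^ p^-1.
    by rewrite -poweRrM mulfV ?gt_eqF // poweRe1 // lee_fin normc_ge0.
  apply: le_poweR; [by rewrite invr_ge0 ltW|exact: poweR_ge0|].
  have [n Hn] := HK f g G l x gG l0.
  apply: (@le_trans _ _ (c%:E * (cube_avg n (fun y => normc (f y) ^+ s) x `^ P)%:E)).
    have av0 : (0 <= cube_avg n (fun y => normc (f y) ^+ s) x)%R.
      by rewrite mulr_ge0 ?invr_ge0 //; apply: sumr_ge0 => u _.
    rewrite poweR_EFin -EFinM lee_fin -powE ?normc_ge0 // -powRM //; last first.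
      by apply: mulr_ge0; [exact: ltW|exact: exprn_ge0].
    apply: ge0_ler_powR => //; rewrite ?nnegrE; first by rewrite exprn_ge0 ?normc_ge0.
    by apply: mulr_ge0 => //; apply: mulr_ge0; [exact: ltW|exact: exprn_ge0].
  by apply: lee_wpmul2l; [rewrite lee_fin|exact: MP].
rewrite GE {1}/lp_norm unlock.
have Ih0 : 0 <= \int[@counting (lattice d) R]_x ((normc (f x) ^+ s) `^ P)%:E.
  by apply: integral_ge0 => x _; rewrite lee_fin powR_ge0.
have fE : clp_norm p%:E f = (\int[@counting (lattice d) R]_x ((normc (f x) ^+ s) `^ P)%:E) `^ p^-1.
  rewrite /clp_norm /lp_norm unlock; congr (_ `^ _); apply: eq_integral => x _.
  by rewrite powE ?normc_ge0 // gee0_abs ?lee_fin ?normc_ge0.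
apply: (@le_trans _ _ ((c%:E * (C%:E * \int[@counting (lattice d) R]_x ((normc (f x) ^+ s) `^ P)%:E)) `^ p^-1)).
  have I0 : 0 <= \int[@counting (lattice d) R]_x (`|spherical_max f g x| `^ p).
    by apply: integral_ge0 => x _; rewrite poweR_ge0.
  apply: le_poweR => //; first by rewrite invr_ge0 ltW.
  apply: (@le_trans _ _ (\int[@counting (lattice d) R]_x (c%:E * M x))).
    by apply: ge0_le_integral => // x _; exact: poweR_ge0.
  rewrite ge0_integralZl //; apply: lee_wpmul2l => //.
have cC0 : 0 <= (c * C)%:E by rewrite lee_fin mulr_ge0 // ltW.
move: Ih0 fE; move: (clp_norm p%:E f) (\int[_]_x _) => nf I I0 ->.
rewrite muleA -EFinM (poweRM _ cC0 I0) poweR_EFin muleAC -EFinM.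
apply: lee_wpmul2r; first exact: poweR_ge0.
have -> : (c * C = K `^ P * C * G `^ p)%R by rewrite cE mulrAC.
rewrite lee_fin powRM; [|by rewrite mulr_ge0 ?powR_ge0 ?(ltW C0)|exact: powR_ge0].
by rewrite -(powRrM G) mulfV ?gt_eqF // powRr1.
Qed.

Theorem theorem1 (R : realType) (d : nat) (p : \bar R) :
  (3 <= d)%N ->
  (d%:R / (d%:R - 2))%:E < p ->
  exists C : R, forall f g : lattice d -> R[i],
    clp_norm p f < +oo ->
    clp_norm +oo g < +oo ->
    lp_norm p (spherical_max f g) <= C%:E * clp_norm p f * clp_norm +oo g.
Proof.
case: p => [p| |] // d3 pd; first exact: spherical_max_fin.
(* At the endpoint an average is at most the product of the two suprema. *)
by exists 1%R => f g foo goo; rewrite mul1e; exact: spherical_max_oo.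
Qed.
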